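(* Let $(Q,\mathcal U)$ and $(Q',\mathcal U')$ be orbifolds. Suppose that $\mathcal V$ is a representative of $\mathcal U$, and $\mathcal V'$ a representative of $\mathcal U'$. If the associated marked atlas groupoids $(\Gamma(\mathcal V),\alpha_{\mathcal V},Q)$ and $(\Gamma(\mathcal V'),\alpha_{\mathcal V'},Q')$ are equal, then the orbifolds $(Q,\mathcal U)$ and $(Q',\mathcal U')$ are equal. More precisely, one even has $\mathcal V=\mathcal V'$.
   Context: All manifolds are real, smooth ($C^\infty$), Hausdorff and paracompact. Let $Q$ be a topological space, $n\in\mathbb N_0$. A (reduced) orbifold chart of dimension $n$ on $Q$ is a triple $(V,G,\varphi)$ where $V$ is a connected $n$-manifold without boundary, $G$ is a finite subgroup of $\mathrm{Diff}(V)$, and $\varphi\colon V\to Q$ is a map with open image inducing a homeomorphism $G\backslash V\to\varphi(V)$. Charts $(V,G,\varphi),(W,H,\psi)$ are compatible if for each $(x,y)\in V\times W$ with $\varphi(x)=\psi(y)$ there are open connected neighborhoods $\widetilde V\subseteq V$ of $x$, $\widetilde W\subseteq W$ of $y$ and a diffeomorphism $h\colon\widetilde V\to\widetilde W$ with $\psi\circ h=\varphi|_{\widetilde V}$. An orbifold atlas is a set of pairwise compatible orbifold charts of the same dimension on $Q$ whose images cover $Q$; two atlases are equivalent if their union is an atlas; an orbifold structure $\mathcal U$ on $Q$ is an equivalence class of atlases, its elements are called representatives of $\mathcal U$. An orbifold is a pair $(Q,\mathcal U)$ with $Q$ a Hausdorff space that is paracompact (resp. second-countable) and $\mathcal U$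 an orbifold structure on $Q$; the result holds in both versions, and in the second-countable version all representatives are taken countable. A transition on a manifold $M$ is a diffeomorphism between open subsets of $M$. For a representative $\mathcal V=\{(V_i,G_i,\pi_i)\mid i\in I\}$ of $\mathcal U$ ($i\mapsto(V_i,G_i,\pi_i)$ bijective) put $V=\coprod_i V_i$ (a manifold whose connected components are identified with the $V_i$), $\pi=\coprod_i\pi_i\colon V\to Q$, and let $\Psi(\mathcal V)$ be the set of transitions $f$ on $V$ with $\pi\circ f=\pi|_{\operatorname{dom}f}$. The atlas groupoid $\Gamma(\mathcal V)$ has objects $\Gamma(\mathcal V)_0=V$ and arrows $\operatorname{germ}_xf$ ($f\in\Psi(\mathcal V)$, $x\in\operatorname{dom}f$), with source $x$, target $f(x)$ and composition of germs; the smooth structure is such that for each $f$ the set $\{\operatorname{germ}_xf\mid x\in\operatorname{dom} f\}$ is open and $\operatorname{germ}_xf\mapsto x$ is a diffeomorphism of it onto $\operatorname{dom}f$. $|\Gamma(\mathcal V)|$ is the orbit space, and $\alpha_{\mathcal V}\colon|\Gamma(\mathcal V)|\to Q$, $[x]\mapsto\pi(x)$, is a homeomorphism. Equality of marked groupoids means equality of the Lie groupoids, of the topological spaces and of the homeomorphisms. *)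

(* Defs.v *)
From HB Require Import structures.
From mathcomp Require Import all_boot all_order all_algebra.
From mathcomp Require Import all_classical all_reals all_analysis.
Import Order.TTheory GRing.Theory Num.Theory.
Import numFieldNormedType.Exports.

Set Implicit Arguments.
Unset Strict Implicit.
Unset Printing Implicit Defensive.

Local Open Scope classical_set_scope.
Local Open Scope ring_scope.

(* Spaces, manifolds and groupoids have to be compared by literal equality, so
   the set-theoretic universe is modelled by ambient types (X for points of
   manifolds, Y for points of orbifolds, J for indices): the underlying sets are
   subsets of these types, partially defined maps are their graphs, and
   structures are records of such data, so that Leibniz equality is
   set-theoretic equality.  The axioms are separate predicates on the data. *)

(* [pmap X Y] is used for (graphs of) maps from a subset of X to Y; domain and
   image of f are the projections f.`1 and f.`2. *)
Definition pmap (X Y : Type) := set (X * Y).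

Section PartialMaps.
Context {X Y Z : Type}.

Definition functional (f : pmap X Y) : Prop :=
  forall x y y', f (x, y) -> f (x, y') -> y = y'.

Definition pinv (f : pmap X Y) : pmap Y X := [set p | f (p.2, p.1)].

(* g after f *)
Definition pcomp (g : pmap Y Z) (f : pmap X Y) : pmap X Z :=
  [set p | exists2 y, f (p.1, y) & g (y, p.2)].

Definition prestr (f : pmap X Y) (A : set X) : pmap X Y :=
  [set p | f p /\ A p.1].

Definition pimg (f : pmap X Y) (A : set X) : set Y :=
  [set y | exists2 x, A x & f (x, y)].

Definition pid (A : set X) : pmap X X := [set p | A p.1 /\ p.2 = p.1].

End PartialMaps.

Record tspace (X : Type) := TSpace { pts : set X; opn : set (set X) }.

Definition is_topology {X : Type} (T : tspace X) : Prop :=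
  [/\ forall U, opn T U -> U `<=` pts T,
      opn T (pts T),
      forall U V, opn T U -> opn T V -> opn T (U `&` V) &
      forall F : set (set X), F `<=` opn T -> opn T (\bigcup_(U in F) U)].

(* The library topological space on the subtype of the points of T.  It is
   generated by the traces of the sets in opn T; when T satisfies [is_topology]
   these traces are exactly the open sets. *)
Definition space {X : Type} (T : tspace X) : Type := set_type (pts T).

HB.instance Definition _ (X : Type) (T : tspace X) :=
  gen_eqMixin (space T).
HB.instance Definition _ (X : Type) (T : tspace X) :=
  gen_choiceMixin (space T).
HB.instance Definition _ (X : Type) (T : tspace X) :=
  isSubBaseTopological.Build (space T) (opn T)
    (fun U : set X => [set x : space T | U (set_val x)]).

Definition paracompact (T : topologicalType) : Prop :=
  forall C : set (set T),
    (forall U, C U -> open U) -> \bigcup_(U in C) U = setT ->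
    exists D : set (set T),
      [/\ forall W, D W -> open W,
          \bigcup_(W in D) W = setT,
          forall W, D W -> exists2 U, C U & W `<=` U &
          forall x : T, exists2 N, nbhs x N &
            finite_set [set W | D W /\ W `&` N !=set0]].

Section Spaces.
Context {X Y : Type}.

(* Connected sets are non-empty here. *)
Definition tconnected (T : tspace X) (A : set X) : Prop :=
  A !=set0 /\ connected [set x : space T | A (set_val x)].

Definition tsub (T : tspace X) (A : set X) : tspace X :=
  TSpace (pts T `&` A) [set U `&` A | U in opn T].

Definition homeo (S : tspace X) (T : tspace Y) (f : pmap X Y) : Prop :=
  [/\ functional f, functional (pinv f), f.`1 = pts S, f.`2 = pts T &
      forall U, U `<=` pts S -> (opn S U <-> opn T (pimg f U))].

(* The class of x under the relation e on T, and the quotient space of T by e,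
   whose points are classes. *)
Definition class (T : tspace X) (e : X -> X -> Prop) (x : X) : set X :=
  [set y | pts T y /\ e x y].

Definition tquot (T : tspace X) (e : X -> X -> Prop) : tspace (set X) :=
  let P := [set class T e x | x in pts T] in
  TSpace P [set U | U `<=` P /\ opn T (\bigcup_(C in U) C)].

(* [x] |-> f x *)
Definition induced (T : tspace X) (e : X -> X -> Prop) (f : pmap X Y) :
    pmap (set X) Y :=
  [set p | exists2 x, p.1 = class T e x & f (x, p.2)].

End Spaces.

Section Manifolds.
Context {R : realType}.

(* C^k on U; for open U only the values of f on U matter. *)
Fixpoint Ck (k : nat) {m n : nat} (U : set 'rV[R]_m)
    (f : 'rV[R]_m -> 'rV[R]_n) : Prop :=
  if k is k'.+1 then
    (forall x, U x -> differentiable f x) /\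
    (forall v, Ck k' U (fun x => 'D_v f x))
  else forall x, U x -> {for x, continuous f}.

Definition eucl_smooth {m n : nat} (g : pmap 'rV[R]_m 'rV[R]_n) : Prop :=
  open g.`1 /\
  exists2 f : 'rV[R]_m -> 'rV[R]_n,
    g = [set p | g.`1 p.1 /\ p.2 = f p.1] & forall k, Ck k g.`1 f.

(* A smooth structure is given by its maximal atlas.  Charts of every dimension
   are allowed in the data, see [is_manifold]. *)
Record manifold (X : Type) := Manifold {
  mset : set X;
  mcharts : forall n : nat, set (pmap X 'rV[R]_n) }.

Definition mtop {X : Type} (M : manifold X) : tspace X :=
  TSpace (mset M)
    [set U | U `<=` mset M /\
      forall n (phi : pmap X 'rV[R]_n), mcharts M phi -> open (pimg phi U)].

Definition chart_on {X : Type} (A : set X) {n} (phi : pmap X 'rV[R]_n) : Prop :=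
  [/\ functional phi, functional (pinv phi),
      phi.`1 !=set0, phi.`1 `<=` A & open phi.`2].

Definition chart_compat {X : Type} {m n}
    (phi : pmap X 'rV[R]_m) (psi : pmap X 'rV[R]_n) : Prop :=
  eucl_smooth (pcomp psi (pinv phi)) /\ eucl_smooth (pcomp phi (pinv psi)).

(* The maximal atlas on A containing the atlas B. *)
Definition max_atlas {X : Type} (A : set X)
    (B : forall n, set (pmap X 'rV[R]_n)) : forall n, set (pmap X 'rV[R]_n) :=
  fun n => [set phi | chart_on A phi /\
    forall m (psi : pmap X 'rV[R]_m), B m psi -> chart_compat phi psi].

(* As the n-dimensional charts cover M and all charts are compatible and
   non-empty, there are no charts of other dimensions. *)
Definition is_manifold {X : Type} (n : nat) (M : manifold X) : Prop :=
  [/\ forall x, mset M x -> exists2 phi, @mcharts X M n phi & phi.`1 x,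
      mcharts M = max_atlas (mset M) (@mcharts X M),
      hausdorff_space (space (mtop M)) &
      paracompact (space (mtop M))].

(* For open f.`1, this is smoothness of f; openness of the domains of the
   coordinate expressions gives continuity. *)
Definition smooth_map {X Y : Type} (M : manifold X) (N : manifold Y)
    (f : pmap X Y) : Prop :=
  forall m n (phi : pmap X 'rV[R]_m) (psi : pmap Y 'rV[R]_n),
    mcharts M phi -> mcharts N psi ->
    eucl_smooth (pcomp psi (pcomp f (pinv phi))).

(* f is a diffeomorphism from an open subset of M to an open subset of N. *)
Definition open_diffeo {X Y : Type} (M : manifold X) (N : manifold Y)
    (f : pmap X Y) : Prop :=
  [/\ functional f /\ functional (pinv f),
      opn (mtop M) f.`1, opn (mtop N) f.`2,
      smooth_map M N f & smooth_map N M (pinv f)].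

Definition transition {X : Type} (M : manifold X) (f : pmap X X) : Prop :=
  open_diffeo M M f.

Definition diff {X : Type} (M : manifold X) : set (pmap X X) :=
  [set f | [/\ open_diffeo M M f, f.`1 = mset M & f.`2 = mset M]].

Definition finite_subgroup {X : Type} (M : manifold X) (G : set (pmap X X)) :
    Prop :=
  [/\ finite_set G, G `<=` diff M, G (pid (mset M)),
      forall g h, G g -> G h -> G (pcomp g h) &
      forall g, G g -> G (pinv g)].

(* The disjoint union of the sets {i} x M i, i in I. *)
Definition coprod {X J : Type} (I : set J) (M : J -> manifold X) :
    manifold (J * X) :=
  let A := [set p : J * X | I p.1 /\ mset (M p.1) p.2] in
  Manifold A (max_atlas A (fun n =>
    [set psi | exists i (phi : pmap X 'rV[R]_n),
       [/\ I i, mcharts (M i) phi &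
           psi = [set p | p.1.1 = i /\ phi (p.1.2, p.2)]]])).

End Manifolds.
Arguments manifold : clear implicits.

Record ochart (R : realType) (X Y : Type) := OChart {
  cdom : manifold R X;
  cgrp : set (pmap X X);
  cmap : pmap X Y }.

Inductive countability := Paracompact | SecondCountable.

Section Orbifolds.
Context {R : realType} {X Y : Type}.
Implicit Types (Q : tspace Y) (c : ochart R X Y).

Definition ctop c : tspace X := mtop (cdom c).

Definition grp_rel (G : set (pmap X X)) (x y : X) : Prop :=
  exists2 g, G g & g (x, y).

Definition is_ochart (n : nat) Q c : Prop :=
  [/\ is_manifold n (cdom c) /\ tconnected (ctop c) (mset (cdom c)),
      finite_subgroup (cdom c) (cgrp c),
      functional (cmap c) /\ (cmap c).`1 = mset (cdom c),
      opn Q (cmap c).`2 &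
      homeo (tquot (ctop c) (grp_rel (cgrp c))) (tsub Q (cmap c).`2)
        (induced (ctop c) (grp_rel (cgrp c)) (cmap c))].

Definition ochart_compat c d : Prop :=
  forall x y q, cmap c (x, q) -> cmap d (y, q) ->
  exists h : pmap X X,
    [/\ open_diffeo (cdom c) (cdom d) h,
        h.`1 x /\ tconnected (ctop c) h.`1,
        h.`2 y /\ tconnected (ctop d) h.`2 &
        pcomp (cmap d) h = prestr (cmap c) h.`1].

Definition is_oatlas Q (V : set (ochart R X Y)) : Prop :=
  [/\ exists n, forall c, V c -> is_ochart n Q c,
      forall c d, V c -> V d -> ochart_compat c d &
      \bigcup_(c in V) (cmap c).`2 = pts Q].

Definition oatlas_equiv Q (V W : set (ochart R X Y)) : Prop :=
  [/\ is_oatlas Q V, is_oatlas Q W & is_oatlas Q (V `|` W)].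

Definition orbifold_structure Q (U : set (set (ochart R X Y))) : Prop :=
  exists2 V, is_oatlas Q V & U = [set W | oatlas_equiv Q V W].

Definition is_orbifold (cnt : countability) Q
    (U : set (set (ochart R X Y))) : Prop :=
  [/\ is_topology Q, hausdorff_space (space Q),
      match cnt with
      | Paracompact => paracompact (space Q)
      | SecondCountable => @second_countable (space Q)
      end &
      orbifold_structure Q U].

Definition representative (cnt : countability)
    (U : set (set (ochart R X Y))) (V : set (ochart R X Y)) : Prop :=
  U V /\ (cnt = SecondCountable -> countable V).

End Orbifolds.

(* The data of a Lie groupoid with objects in P and arrows in A;
   [gmul] maps (b, a) with source b = target a to the composite b a. *)
Record groupoid (R : realType) (P A : Type) := Groupoid {
  gobj : manifold R P;
  garr : manifold R A;
  gsrc : pmap A P;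
  gtgt : pmap A P;
  gunit : pmap P A;
  ginv : pmap A A;
  gmul : pmap (A * A) A }.

Record marked_groupoid (R : realType) (P A Y : Type) := MarkedGroupoid {
  mgroupoid : groupoid R P A;
  mspace : tspace Y;
  mhomeo : pmap (set P) Y }.

Section OrbitSpace.
Context {R : realType} {P A : Type} (G : groupoid R P A).

Definition orbit_rel (x y : P) : Prop :=
  exists a, gsrc G (a, x) /\ gtgt G (a, y).

(* The orbit space |G|; its points are the orbits. *)
Definition orbit_space : tspace (set P) := tquot (mtop (gobj G)) orbit_rel.

End OrbitSpace.

Section AtlasGroupoid.
Context {R : realType} {X Y J : Type}.
(* The family of orbifold charts c i, i in I, of an orbifold atlas. *)
Variables (I : set J) (c : J -> ochart R X Y).

Let P : Type := (J * X)%type.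
Let A : Type := (P * set (pmap P P))%type.

Definition ag_obj : manifold R P := coprod I (fun i => cdom (c i)).

Definition ag_proj : pmap P Y :=
  [set p | I p.1.1 /\ cmap (c p.1.1) (p.1.2, p.2)].

Definition Psi : set (pmap P P) :=
  [set f | transition ag_obj f /\ pcomp ag_proj f = prestr ag_proj f.`1].

(* The germ of f at x: the point x together with the set of all transitions
   that agree with f on a neighborhood of x. *)
Definition germ (x : P) (f : pmap P P) : A :=
  (x, [set g | transition ag_obj g /\
         exists N, [/\ opn (mtop ag_obj) N, N x, N `<=` f.`1 &
                       prestr g N = prestr f N]]).

Definition germ_set : set A :=
  [set a | exists x f, [/\ Psi f, f.`1 x & a = germ x f]].

(* The inverses of the maps germ_x f |-> x, for x in the domain of a fixed f
   in Psi, are the local parametrizations defining the smooth structure. *)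
Definition ag_arr : manifold R A :=
  Manifold germ_set (max_atlas germ_set (fun n =>
    [set psi | exists f (phi : pmap P 'rV[R]_n),
       [/\ Psi f, mcharts ag_obj phi &
           psi = pcomp phi [set p | f.`1 p.2 /\ p.1 = germ p.2 f]]])).

Definition atlas_groupoid : groupoid R P A :=
  {| gobj := ag_obj;
     garr := ag_arr;
     gsrc := [set p | exists x f, [/\ Psi f, f.`1 x & p = (germ x f, x)]];
     gtgt := [set p | exists x y f,
               [/\ Psi f, f (x, y) & p = (germ x f, y)]];
     gunit := [set p | exists2 x,
               mset ag_obj x & p = (x, germ x (pid (mset ag_obj)))];
     ginv := [set p | exists x y f,
               [/\ Psi f, f (x, y) & p = (germ x f, germ y (pinv f))]];
     gmul := [set p | exists x y f g,
               [/\ Psi f, Psi g, f (x, y), g.`1 y &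
                   p = ((germ y g, germ x f), germ x (pcomp g f))]] |}.

(* alpha : |Gamma| -> Q, [x] |-> pi x *)
Definition ag_marking : pmap (set P) Y :=
  induced (mtop ag_obj) (orbit_rel atlas_groupoid) ag_proj.

Definition marked_atlas_groupoid (Q : tspace Y) : marked_groupoid R P A Y :=
  MarkedGroupoid atlas_groupoid Q ag_marking.

End AtlasGroupoid.

(* Main.v *)
(* The objects of the atlas groupoid recover the index set and the smooth
   structures of the charts, since the manifolds V_i are non-empty; the marking
   sends the orbit of x to pi(x), hence recovers the maps pi_i.  The group G_i
   is determined by V_i and pi_i: it consists of all diffeomorphisms f of V_i
   with pi_i f = pi_i.  Indeed such an f maps every point into its G_i-orbit, so
   V_i is the finite union of the closed sets F_g (g in G_i), where F_g is the
   closure of the interior of {f = g}.  At a point of the intersection of F_g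
   and F_h, the maps g and h both have the same value and the same differential
   as f, so h^-1 g fixes the point with differential the identity; being of
   finite order it is the identity near the point (Bochner), hence everywhere.
   So the F_g are disjoint and, V_i being connected, one of them is V_i.
   Finally V determines the orbifold structure as equivalence of atlases is
   transitive. *)

From mathcomp Require Import all_boot all_order all_algebra.
From mathcomp Require Import all_classical all_reals all_analysis.
From mathcomp Require Import finmap ring lra.
Require Import Defs.
Import Order.TTheory GRing.Theory Num.Theory.
Import numFieldNormedType.Exports.

Set Implicit Arguments.
Unset Strict Implicit.
Unset Printing Implicit Defensive.

Local Open Scope classical_set_scope.
Local Open Scope ring_scope.

(** * Calculus of C^k maps *)

Section Calculus.
Context {R : realType}.

(** The delicate point is Bochner's statement for a diffeomorphism [k] of finite order. The usual
    proof averages a chart over the powers of [k] so that [k] becomes linear; here no new chart is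
    built. That [k] fixes x with differential the identity is expressed in one fixed chart as strict
    differentiability: near x, [k] minus the identity has arbitrarily small Lipschitz constant. This
    form passes to compositions by estimates alone, so it holds for all powers of [k]. It also
    survives at limit points of an open set of fixed points, because the derivatives of a smooth map
    are continuous. The map [f] to be located in [G] is not known to have finite order, so Bochner's
    argument can only be applied to elements of [G], with [f] as an intermediate step. That the sets
    F_g cover V_i rests on the finiteness of G_i: finitely many closed sets without interior in a
    non-empty open set cannot fill it. *)

Lemma near0_differentiable (V W : normedModType R) (e : V -> W) (x : V) :
  (\near x, e x = 0) -> differentiable e x.
Proof.
move=> ne.
have e0 : e x = 0 by exact: nbhs_singleton ne.
have H : e \o shift x = cst (e x) + (\0 : {linear V -> W}) +o_ 0 id.
  have ne' : \forall h \near (0 : V), e (h + x) = 0.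
    by move: ne; rewrite (near_shift (0 : V)) /= subr0.
  apply/eqaddoP => eps eps0; near=> h; have eh : e (h + x) = 0 by near: h.
  rewrite [X in `|X|](_ : _ = 0) ?normr0 ?mulr_ge0 ?(ltW eps0)//.
  by rewrite !fctE /= eh e0 addr0 subr0.
have d0 := @diff_unique _ _ _ e (\0 : {linear V -> W}) x.
have c0 : continuous (\0 : {linear V -> W}) by move=> ?; exact: cvg_cst.
by apply/diff_locallyP; rewrite d0.
Unshelve. all: by end_near. Qed.

Lemma near_eq_differentiable (V W : normedModType R) (f g : V -> W) (x : V) :
  (\near x, f x = g x) -> differentiable f x -> differentiable g x.
Proof.
move=> fg df; rewrite (_ : g = f + (g - f)); last by rewrite addrC subrK.
apply: differentiableD => //; apply: near0_differentiable.
by apply: filterS fg => y fg; rewrite !fctE fg subrr.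
Qed.

Lemma Ck_eq k m n (U : set 'rV[R]_m) (f g : 'rV[R]_m -> 'rV[R]_n) :
  open U -> (forall x, U x -> f x = g x) -> Ck k U f -> Ck k U g.
Proof.
move=> oU; elim: k f g => [|k IH] f g fg /=.
  move=> cf x Ux.
  have nfg : \near x, g x = f x.
    by apply: filterS (open_nbhs_nbhs (conj oU Ux)) => y /fg.
  rewrite /prop_for /continuous_at -(fg x Ux).
  have cfx : f y @[y --> x] --> f x := cf x Ux.
  by move=> P /cfx; apply: filterS2 nfg => y /= ->.
have nfg x : U x -> \near x, f x = g x.
  by move=> Ux; apply: filterS (open_nbhs_nbhs (conj oU Ux)) => y /fg.
move=> [df Df]; split=> [x Ux|v].
  exact: near_eq_differentiable (nfg x Ux) (df x Ux).
apply: (IH ('D_v f)) => [x Ux|]; last exact: Df.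
by rewrite (near_eq_derive v (nfg x Ux)).
Qed.

(** [Ck] constrains a total function at the points of a set, and its derivatives look at a full
    neighborhood in the whole space. Hence the sets [N] may be arbitrary, and restriction to a
    subset is a special case. *)
Lemma Ck_local k m n (U : set 'rV[R]_m) (f : 'rV[R]_m -> 'rV[R]_n) :
  (forall x, U x -> exists2 N : set 'rV[R]_m, N x & Ck k N f) -> Ck k U f.
Proof.
elim: k f => [|k IH] f H /=; first by move=> x /H[N Nx]; exact.
split=> [x /H[N Nx /= [df _]]|v]; first exact: df.
by apply: IH => x /H[N Nx /= [_ ?]]; exists N.
Qed.

Lemma Ck_sub k m n (U N : set 'rV[R]_m) (f : 'rV[R]_m -> 'rV[R]_n) :
  N `<=` U -> Ck k U f -> Ck k N f.
Proof. by move=> NU CU; apply: Ck_local => x /NU; exists U. Qed.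

Lemma CkS k m n (U : set 'rV[R]_m) (f : 'rV[R]_m -> 'rV[R]_n) :
  Ck k.+1 U f -> Ck k U f.
Proof.
elim: k f => [|k IH] f /= [df Df]; first by move=> x /df /differentiable_continuous.
by split=> // v; apply: IH.
Qed.

Lemma Ck_cst k m n (U : set 'rV[R]_m) (a : 'rV[R]_n) :
  Ck k U (fun=> a).
Proof.
elim: k a => [|k IH] a /=; first by move=> x _; exact: cst_continuous.
split=> [x _|v]; first exact: differentiable_cst.
have -> : (fun x => 'D_v (fun=> a) x) = (fun _ : 'rV[R]_m => 0).
  by apply/funext => x; exact: derive_cst.
exact: IH.
Qed.

Lemma CkD k m n (U : set 'rV[R]_m) (f g : 'rV[R]_m -> 'rV[R]_n) :
  open U -> Ck k U f -> Ck k U g -> Ck k U (fun x => f x + g x).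
Proof.
move=> oU; elim: k f g => [|k IH] f g /=.
  by move=> cf cg x Ux; apply: continuousD; [exact: cf|exact: cg].
move=> [df Df] [dg Dg]; split=> [x Ux|v].
  by apply: differentiableD; [exact: df|exact: dg].
apply: Ck_eq (IH _ _ (Df v) (Dg v)) => // x Ux.
by rewrite [RHS]deriveD//; apply/diff_derivable; [exact: df|exact: dg].
Qed.

Lemma Ck_sum k m n p (U : set 'rV[R]_m) (f : 'I_p -> 'rV[R]_m -> 'rV[R]_n) :
  open U -> (forall i, Ck k U (f i)) -> Ck k U (fun x => \sum_(i < p) f i x).
Proof.
move=> oU Cf.
elim: p f Cf => [|p IH] f Cf.
  rewrite (_ : (fun _ => _) = fun=> 0); first exact: Ck_cst.
  by apply/funext => x; rewrite big_ord0.
rewrite (_ : (fun _ => _) =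
  fun x => f ord0 x + \sum_(i < p) f (lift ord0 i) x).
  by apply: CkD => //; exact: IH.
by apply/funext => x; rewrite big_ord_recl.
Qed.

Lemma derivable_coord (V : normedModType R) n (a : V -> 'rV[R]_n) x v j :
  derivable a x v -> derivable (fun y => a y 0 j) x v.
Proof. by move/derivable_mxP; apply. Qed.

Lemma derive_coord (V : normedModType R) n (a : V -> 'rV[R]_n) x v j :
  derivable a x v -> 'D_v (fun y => a y 0 j) x = ('D_v a x) 0 j.
Proof. by move/derive_mx ->; rewrite mxE. Qed.

Lemma differentiable_coord_comp (V : normedModType R) n (a : V -> 'rV[R]_n) x j :
  differentiable a x -> differentiable (fun y => a y 0 j : R) x.
Proof.
move=> da; apply: (@differentiable_comp _ _ _ _ a (fun N : 'rV[R]_n => N 0 j : R)) => //.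
exact: differentiable_coord.
Qed.

Lemma differentiable_scale (V : normedModType R) n (a : V -> R) (f : V -> 'rV[R]_n) x :
  differentiable a x -> differentiable f x -> differentiable (fun y => a y *: f y) x.
Proof.
move=> da df.
rewrite (_ : (fun _ => _) = \sum_(j < n) (fun y => (a y * f y 0 j) *: delta_mx 0 j)).
  apply: differentiable_sum => j; apply: differentiableZl.
  by apply: differentiableM => //; exact: differentiable_coord_comp.
apply/funext => y; rewrite fct_sumE {1}(row_sum_delta (f y)) scaler_sumr.
apply: eq_bigr => j _; by rewrite scalerA.
Qed.

Lemma derive_scale (V : normedModType R) n (a : V -> R) (f : V -> 'rV[R]_n) x v :
  differentiable a x -> differentiable f x ->
  'D_v (fun y => a y *: f y) x = 'D_v a x *: f x + a x *: 'D_v f x.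
Proof.
move=> da df; rewrite derive_mx; last exact/diff_derivable/differentiable_scale.
apply/rowP => j; rewrite !mxE.
rewrite (_ : (fun _ => _) = a * (fun y => f y 0 j)); last first.
  by apply/funext => y; rewrite mxE.
rewrite deriveM; [|exact/diff_derivable|exact/derivable_coord/diff_derivable].
rewrite derive_coord//; last exact/diff_derivable.
by rewrite addrC; congr (_ + _); exact: mulrC.
Qed.

(** [Ck] speaks of row-vector valued maps only, so a scalar factor enters as a coordinate of such a
    map. This is the shape in which the chain rule produces it. *)
Lemma CkZ k m n p (U : set 'rV[R]_m) (a : 'rV[R]_m -> 'rV[R]_p) j
    (g : 'rV[R]_m -> 'rV[R]_n) :
  open U -> Ck k U a -> Ck k U g -> Ck k U (fun x => a x 0 j *: g x).
Proof.
move=> oU; elim: k a g => [|k IH] a g.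
  move=> /= ca cg x Ux; apply: continuousZ; last exact: cg.
  apply: (@continuous_comp _ _ _ a (fun N : 'rV[R]_p => N 0 j : R)); first exact: ca.
  exact: coord_continuous.
move=> Ca Cg; have [da Da] := Ca; have [dg Dg] := Cg.
split=> [x Ux|v].
  by apply: differentiable_scale; [exact/differentiable_coord_comp/da|exact: dg].
apply: (@Ck_eq k _ _ _ (fun x => ('D_v a x) 0 j *: g x + a x 0 j *: 'D_v g x)) => //.
  move=> x Ux; rewrite derive_scale; [|exact/differentiable_coord_comp/da|exact: dg].
  by rewrite derive_coord//; exact/diff_derivable/da.
by apply: CkD => //; apply: IH; (exact: Da || exact: Dg || exact: CkS).
Qed.

(** By the chain rule the derivative of the composite along [v] is the sum over j of the j-th
    coordinate of ['D_v f] times the j-th partial derivative of [g] at [f x]. The induction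
    hypothesis applies to the latter factor, where [f] has one order of differentiability to
    spare. *)
Lemma Ck_comp k m n p (U : set 'rV[R]_m) (W : set 'rV[R]_n)
    (f : 'rV[R]_m -> 'rV[R]_n) (g : 'rV[R]_n -> 'rV[R]_p) :
  open U -> (forall x, U x -> W (f x)) -> Ck k U f -> Ck k W g ->
  Ck k U (g \o f).
Proof.
move=> oU fUW; elim: k f g fUW => [|k IH] f g fUW.
  by move=> /= cf cg x Ux; apply: continuous_comp; [exact: cf|exact/cg/fUW].
move=> Cf Cg; have [df Df] := Cf; have [dg Dg] := Cg.
split=> [x Ux|v].
  by apply: differentiable_comp; [exact: df|exact/dg/fUW].
apply: (@Ck_eq k _ _ _
  (fun x => \sum_(j < n) ('D_v f x) 0 j *: (fun y => 'D_(delta_mx 0 j) g y) (f x))) => //.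
  move=> x Ux; rewrite [RHS]deriveE; last first.
    by apply: differentiable_comp; [exact: df|exact/dg/fUW].
  rewrite [in RHS]diff_comp; [|exact: df|exact/dg/fUW].
  rewrite [RHS]/= -(deriveE _ (df x Ux)).
  rewrite [in RHS](row_sum_delta ('D_v f x)) linear_sum.
  apply: eq_bigr => j _; by rewrite linearZ /= (deriveE _ (dg _ (fUW x Ux))).
apply: Ck_sum => // j; apply: CkZ => //; first exact: Df.
exact: (IH f (fun y => 'D_(delta_mx 0 j) g y) fUW (CkS Cf) (Dg _)).
Qed.

End Calculus.

(** * Smooth partial maps between Euclidean spaces *)

Section EuclideanSmooth.
Context {R : realType}.

Lemma domI (X Y : Type) (f : pmap X Y) x y : f (x, y) -> f.`1 x.
Proof. by exists y. Qed.

Lemma codI (X Y : Type) (f : pmap X Y) x y : f (x, y) -> f.`2 y.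
Proof. by exists x. Qed.

Lemma functional_pcomp (X Y Z : Type) (g : pmap Y Z) (f : pmap X Y) :
  functional g -> functional f -> functional (pcomp g f).
Proof.
move=> fg ff x z z' [y fxy gyz] [y' fxy' gyz'].
by move: gyz; rewrite (ff _ _ _ fxy fxy') => gyz; exact: fg gyz gyz'.
Qed.

Lemma functional_prestr (X Y : Type) (f : pmap X Y) A :
  functional f -> functional (prestr f A).
Proof. by move=> ff x y y' [fy _] [fy' _]; exact: ff fy fy'. Qed.

Lemma pinvK (X Y : Type) (f : pmap X Y) : pinv (pinv f) = f.
Proof. by apply/seteqP; split=> -[]. Qed.

Lemma pinv_pcomp (X Y Z : Type) (g : pmap Y Z) (f : pmap X Y) :
  pinv (pcomp g f) = pcomp (pinv f) (pinv g).
Proof. by apply/seteqP; split=> -[x z] [y /= ? ?]; exists y. Qed.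

Lemma pcompA (X Y Z T : Type) (h : pmap Z T) (g : pmap Y Z) (f : pmap X Y) :
  pcomp h (pcomp g f) = pcomp (pcomp h g) f.
Proof.
apply/seteqP; split=> -[x t] /=.
  by move=> [z [y /= fxy gyz] hzt]; exists y => //; exists z.
by move=> [y fxy [z /= gyz hzt]]; exists z => //; exists y.
Qed.

Lemma eucl_smooth_locally m n (g : pmap 'rV[R]_m 'rV[R]_n) :
  functional g ->
  (forall x, g.`1 x -> exists g', [/\ eucl_smooth g', g' `<=` g & g'.`1 x]) ->
  eucl_smooth g.
Proof.
move=> fg H; split.
  rewrite (_ : g.`1 = \bigcup_(h in [set h | eucl_smooth h /\ h `<=` g]) h.`1).
    by apply: bigcup_open => h [[]].
  apply/seteqP; split=> [x /H[h [? ? ?]]|x [h [_ hg] [y hxy]]].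
    by exists h.
  by exists y; exact: hg.
(* The total extension takes the default value 0 off the domain of [g]; the condition [Ck] on this
   open domain does not see it. *)
pose f x := xget 0 [set y | g (x, y)].
have fE x y : g (x, y) -> f x = y.
  move=> gxy; rewrite /f; case: xgetP => [z _ gxz|/(_ y)//].
  exact: fg gxz gxy.
exists f.
  apply/seteqP; split=> -[x y] /=.
    by move=> gxy; split; [exact: domI gxy|rewrite (fE _ _ gxy)].
  by move=> [[z gxz] ->]; rewrite (fE _ _ gxz).
move=> k; apply: Ck_local => x /H[h [[oh [e he Ce]] hg hx]].
exists h.`1 => //; apply: Ck_eq (Ce k) => // z hz.
by apply/esym/fE/hg; rewrite he.
Qed.

Lemma eucl_smooth_prestr m n (g : pmap 'rV[R]_m 'rV[R]_n) O :
  open O -> eucl_smooth g -> eucl_smooth (prestr g O).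
Proof.
move=> oO [og [f gf Cf]].
have dE : (prestr g O).`1 = g.`1 `&` O.
  apply/seteqP; split=> x; first by move=> [y [gxy Ox]]; split=> //; exists y.
  by move=> [[y gxy] Ox]; exists y.
split; first by rewrite dE; exact: openI.
exists f => [|k].
  rewrite dE; apply/seteqP; split=> -[x y].
    by move=> [+ Ox]; rewrite {1}gf => -[/= ? ?].
  by move=> [/= [gx Ox] ->]; split=> //; rewrite gf.
by rewrite dE; apply: Ck_sub (Cf k) => x [].
Qed.

Lemma eucl_smooth0 m n : eucl_smooth (set0 : pmap 'rV[R]_m 'rV[R]_n).
Proof. by apply: eucl_smooth_locally => [x y y' []|x [y []]]. Qed.

Lemma eucl_smooth_preimage m n (g : pmap 'rV[R]_m 'rV[R]_n) O :
  eucl_smooth g -> open O -> open [set x | exists2 y, g (x, y) & O y].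
Proof.
move=> [og [f gf Cf]] oO; rewrite openE => x [y]; rewrite {1}gf => -[/= gx ->] Ofx.
rewrite /interior; near=> z.
have gz : g.`1 z by near: z; exact: open_nbhs_nbhs.
exists (f z); first by rewrite gf.
near: z; exact: (Cf 0%N x gx _ (open_nbhs_nbhs (conj oO Ofx))).
Unshelve. all: by end_near. Qed.

Lemma eucl_smooth_pcomp m n p (g : pmap 'rV[R]_m 'rV[R]_n)
    (h : pmap 'rV[R]_n 'rV[R]_p) :
  eucl_smooth g -> eucl_smooth h -> eucl_smooth (pcomp h g).
Proof.
move=> sg sh.
have dE : (pcomp h g).`1 = [set x | exists2 y, g (x, y) & h.`1 y].
  apply/seteqP; split=> x; first by move=> [z [y ? ?]]; exists y => //; exists z.
  by move=> [y ? [z ?]]; exists z, y.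
have od : open (pcomp h g).`1.
  by rewrite dE; apply: eucl_smooth_preimage => //; have [] := sh.
split => //.
have [og [f gf Cf]] := sg; have [oh [e he Ce]] := sh.
exists (e \o f) => [|k].
  apply/seteqP; split=> -[x z].
    move=> [y /= gxy hyz]; split; first by exists z, y.
    by move: gxy hyz; rewrite gf he => -[_ /= ->] [_ ->].
  move=> [[z' [y /= gxy hyz']] /= ->]; exists y => //.
  have hy := domI hyz'; rewrite he; split => //=.
  by move: gxy; rewrite gf => -[_ /= ->].
apply: (@Ck_comp _ k _ _ _ _ h.`1) => //.
  by rewrite dE => x [y]; rewrite {1}gf => -[_ /= ->].
by apply: Ck_sub (Cf k) => x [z [y gxy _]]; exists y.
Qed.

(** Invariance of dimension in the smooth category: the chain rule at [y] factors the identity of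
    R^n through R^m. *)
Lemma eucl_smooth_dim m n (g : pmap 'rV[R]_m 'rV[R]_n) x y :
  eucl_smooth g -> eucl_smooth (pinv g) -> g (x, y) -> (n <= m)%N.
Proof.
move=> [og [f gf Cf]] [oh [e he Ce]] gxy.
have y' : (pinv g).`1 y by exists x.
have xe : x = e y.
  by have : pinv g (y, x) by []; rewrite he => -[].
have x' : g.`1 x by exists y.
have dfx : differentiable f x by have [+ _] := Cf 1%N; apply.
have dey : differentiable e y by have [+ _] := Ce 1%N; apply.
have nfe : \near y, (f \o e) y = y.
  apply: filterS (open_nbhs_nbhs (conj oh y')) => z [w gwz] /=.
  have : pinv g (z, w) by []; rewrite he => -[_ /= <-].
  by have : g (w, z) by []; rewrite gf => -[].
have De v : v = 'd f x ('d e y v).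
  rewrite -[LHS](derive_id y v) -(near_eq_derive v nfe) deriveE; last first.
    by apply: differentiable_comp => //; rewrite -xe.
  by rewrite diff_comp -?xe.
have : lin1_mx ('d e y) *m lin1_mx ('d f x) = 1%:M.
  apply/row_matrixP => i; rewrite row_mul rowE (mul_rV_lin1 ('d e y)).
  by rewrite (mul_rV_lin1 ('d f x)) [RHS]rowE mulmx1; exact/esym/De.
exact: mulmx1_min.
Qed.

End EuclideanSmooth.

(** * Strict differentiability with derivative the identity *)

Section StrictIdentity.
Context {R : realType}.

(** The norm of a row vector is the maximum over its coordinates, so the one-variable mean value
    theorem can be applied to each coordinate along the segment without spoiling the constant. *)
Lemma mean_value n (g : 'rV[R]_n -> 'rV[R]_n) (y z : 'rV[R]_n) (C : R) :
  (forall t : R, 0 <= t <= 1 -> differentiable g (z + t *: (y - z))) ->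
  (forall t : R, 0 <= t <= 1 -> `|'D_(y - z) g (z + t *: (y - z))| <= C) ->
  `|g y - g z| <= C.
Proof.
move=> dg DC; set w := y - z.
have C0 : 0 <= C by apply: le_trans (DC 0 _); rewrite ?lexx ?ler01.
rewrite [leLHS]/Num.Def.normr/= mx_normrE (bigmax_le _ C0)//= => -[i l] _ /=.
pose a (t : R) := z + t *: w.
pose h (t : R) := g (a t) 0 l : R.
have da t : is_diff t a ( *:%R^~ w).
  have := is_diffD (is_diff_cst z t) (is_diff_scalel t w).
  by rewrite add0r.
have dh (t : R) : 0 <= t <= 1 -> is_derive t 1 h (('D_w g (a t)) 0 l).
  move=> t01; have dga := dg t t01.
  have [dat vat] := da t.
  have dgat : differentiable (g \o a) t by exact: differentiable_comp.
  apply: DeriveDef.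
    exact/(derivable_coord (a := g \o a))/diff_derivable.
  rewrite (derive_coord (a := g \o a)); last exact/diff_derivable.
  rewrite (deriveE _ dgat) (diff_comp dat dga).
  by rewrite /= vat scale1r (deriveE _ dga).
have [| |c c01] := @MVT_segment _ h (fun t => ('D_w g (a t)) 0 l) 0 1 ler01.
- by move=> t; rewrite in_itv/= => /andP[t0 t1]; apply: dh; rewrite !ltW.
- apply: derivable_within_continuous => t t01.
  by have [] := dh t t01.
rewrite subr0 mulr1 /h /a scale0r addr0 scale1r /w [z + _]addrC subrK => E.
rewrite (ord1 i) !mxE E.
apply: le_trans (DC c _); last by [].
rewrite [leRHS]/Num.Def.normr/= mx_normrE.
exact: (le_bigmax _ (fun i => `|'D_(y - z) g (z + c *: (y - z)) i.1 i.2|) (0, l)).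
Qed.

(** On the open set [A] the derivative of [f] along [v] is [v], and by continuity this persists at
    the limit point [p]. Then [f] minus the identity has small partial derivatives on a ball around
    [p], which is convex, and the mean value inequality applies there. *)
Lemma strict_identity n (f : 'rV[R]_n -> 'rV[R]_n) (O A : set 'rV[R]_n) p (eps : R) :
  open O -> Ck 1 O f -> O p -> open A -> (forall x, A x -> f x = x) ->
  (forall N, nbhs p N -> A `&` N !=set0) -> 0 < eps ->
  exists2 r : R, 0 < r & forall y z, ball p r y -> ball p r z ->
    `|f y - f z - (y - z)| <= eps * `|y - z|.
Proof.
move=> oO [df Df] Op oA fA cA eps0.
have Dp v : 'D_v f p = v.
  apply/eqP; rewrite -subr_eq0 -normr_eq0; apply/negP => /negP n0.
  have e0 : 0 < `|'D_v f p - v| by rewrite lt_neqAle eq_sym n0 normr_ge0.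
  have /cvgrPdist_lt/(_ _ e0) H : 'D_v f y @[y --> p] --> 'D_v f p := Df v p Op.
  have [y [Ay]] := cA _ H.
  rewrite (_ : 'D_v f y = v) ?ltxx//.
  rewrite -[RHS](derive_id y v); apply: near_eq_derive.
  by apply: filterS (open_nbhs_nbhs (conj oA Ay)) => z /fA.
(* Bounding the derivative along a vector by the n partial derivatives costs a factor n; dividing by
   n + 1 instead keeps [d] positive when n = 0. *)
pose d := eps / n.+1%:R.
have d0 : 0 < d by rewrite divr_gt0.
pose g x := f x - x.
have dg x : O x -> differentiable g x.
  by move=> Ox; apply: differentiableB; [exact: df|exact: ex_diff].
have Dg x v : O x -> 'D_v g x = 'D_v f x - v.
  move=> Ox; rewrite [LHS]deriveB ?derive_id//; first exact/diff_derivable/df.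
have nj : \forall x \near p, O x /\ forall j : 'I_n, `|'D_(delta_mx 0 j) g x| <= d.
  near=> x; have Ox : O x by near: x; exact: open_nbhs_nbhs.
  split=> // j; rewrite Dg// distrC; move: j; near: x.
  apply: filter_forall => j.
  have /cvgrPdist_le/(_ _ d0) :=
    (Df (delta_mx 0 j) p Op : 'D_(delta_mx 0 j) f y @[y --> p] --> _).
  by rewrite Dp.
have /nbhs_ballP[r /= r0 Hr] := nj.
exists r => // y z By Bz.
have Bt t : 0 <= t <= 1 -> ball p r (z + t *: (y - z)).
  move=> /andP[t0 t1]; move: By Bz; rewrite -ball_normE /ball_/= => By Bz.
  rewrite (_ : p - _ = t *: (p - y) + (1 - t) *: (p - z)); last first.
    rewrite scalerBl !scalerBr scale1r; apply/rowP => j; rewrite !mxE; ring.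
  apply: le_lt_trans (ler_normD _ _) _; rewrite !normrZ !ger0_norm ?subr_ge0//.
  (* The strict inequality is taken from the summand with factor t, hence the separate case t =
     0. *)
  have [->|tn0] := eqVneq t 0; first by rewrite mul0r add0r subr0 mul1r.
  rewrite (_ : r = t * r + (1 - t) * r); last by rewrite -mulrDl addrC subrK mul1r.
  apply: ltr_leD; first by rewrite ltr_pM2l// lt_neqAle eq_sym tn0.
  by rewrite ler_wpM2l ?subr_ge0// ltW.
rewrite (_ : f y - f z - (y - z) = g y - g z); last first.
  by rewrite /g; apply/rowP => j; rewrite !mxE; ring.
apply: mean_value => t /Bt/Hr[Ox xd]; first exact: dg.
set x := z + _ in Ox xd *; set w := y - z.
rewrite (deriveE _ (dg x Ox)) [w in leLHS]row_sum_delta linear_sum.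
apply: le_trans (ler_norm_sum _ _ _) _.
apply: (@le_trans _ _ (\sum_(j < n) d * `|w|)).
  apply: ler_sum => j _; rewrite linearZ /= normrZ mulrC -(deriveE _ (dg x Ox)).
  apply: ler_pM => //.
  rewrite [leRHS]/Num.Def.normr/= mx_normrE.
  exact: (le_bigmax _ (fun i => `|w i.1 i.2|) (0, j)).
rewrite sumr_const card_ord -mulr_natl mulrA ler_wpM2r// /d.
rewrite mulrCA ler_piMr ?(ltW eps0)// ler_pdivrMr// mul1r ler_nat.
exact: leqnSn.
Unshelve. all: by end_near. Qed.

End StrictIdentity.

(** * Topology and smooth atlases *)

Section Topology.
Context {X : Type} (T : tspace X).

Lemma opn_open (U : set X) :
  opn T U -> open ([set x | U (set_val x)] : set (space T)).
Proof.
move=> oU; exists [set [set x : space T | U (set_val x)]]; last by rewrite bigcup_set1.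
move=> _ ->; exists [fset U]%fset; first by move=> V /fset1P ->; exact: mem_set.
by apply/seteqP; split => x /= H; [apply: H; exact: fset11|move=> V /fset1P ->].
Qed.

Hypothesis top : is_topology T.

Lemma open_opn (O : set (space T)) :
  open O -> exists2 U, opn T U & O = [set x | U (set_val x)].
Proof.
have [Tsub TT TI TU] := top.
have base (E : {fset set X}) : {subset E <= opn T} -> exists2 U, opn T U &
    \bigcap_(i in [set` E]) [set x : space T | i (set_val x)] = [set x | U (set_val x)].
  move=> ET; rewrite bigcap_fset big_seq.
  elim/big_ind: _ => [|A B [U oU ->] [V oV ->]|i /ET iT].
  - exists (pts T) => //; apply/seteqP; split=> // x _ /=.
    exact: (set_valP x).
  - by exists (U `&` V); first exact: TI.
  - by exists i => //; exact: set_mem iT.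
move=> [D' sD' <-].
(* Taking every open set whose trace belongs to [D'] avoids choosing one for each member. *)
exists (\bigcup_(U in [set U | opn T U /\
    exists2 A, D' A & A = [set x | U (set_val x)]]) U).
  by apply: TU => U [].
apply/seteqP; split=> x /=.
  move=> [A D'A Ax]; have [E ET EA] := sD' _ D'A.
  have [U oU UE] := base E ET.
  have AU : A = [set x | U (set_val x)] by rewrite -UE -EA.
  exists U; last by rewrite AU in Ax.
  by split=> //; exists A.
by move=> [U [oU [A D'A AU]] Ux]; exists A => //; rewrite AU.
Qed.

(* Connectedness without the subtype of points. *)
Definition inseparable (A : set X) := forall U W, opn T U -> opn T W ->
  A `<=` U `|` W -> A `&` (U `&` W) = set0 -> A `&` U !=set0 -> A `<=` U.

Lemma tconnected_inseparable (A : set X) :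
  A `<=` pts T -> tconnected T A -> inseparable A.
Proof.
move=> AT [_ cA] U W oU oW AUW AUW0 [a [Aa Ua]].
have E : [set x : space T | A (set_val x) /\ U (set_val x)] = [set x | A (set_val x)].
  apply: cA.
  - have Ta := AT _ Aa.
    by exists (SigSub (mem_set Ta) : space T).
  - by exists [set x : space T | U (set_val x)] => //; exact: opn_open.
  - exists (~` [set x : space T | W (set_val x)]); first exact/open_closedC/opn_open.
    apply/seteqP; split=> x /= [Ax H]; split=> //.
      by move=> Wx; have : (A `&` (U `&` W)) (set_val x) by []; rewrite AUW0.
    by case: (AUW _ Ax).
move=> x Ax; have Tx := AT _ Ax.
have : [set x : space T | A (set_val x)] (SigSub (mem_set Tx) : space T) by [].
by rewrite -E => -[].
Qed.

Lemma inseparable_tconnected (A : set X) : A `<=` pts T -> A !=set0 ->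
  inseparable A -> tconnected T A.
Proof.
move=> AT A0 iA; split=> // B [b Bb] [C /open_opn[U oU ->] BC] [F cF BF].
have /open_opn[W oW FW] : open (~` F) by rewrite openC.
apply/seteqP; split=> x /=; first by rewrite BC => -[].
move=> Ax; rewrite BC; split=> //; apply: (iA U W) => //.
- move=> y Ay; have Ty := AT _ Ay.
  pose y' := SigSub (mem_set Ty) : space T.
  have [By|nBy] := pselect (B y').
    by left; move: By; rewrite BC => -[].
  right; have : (~` F) y' by move=> Fy; apply: nBy; rewrite BF.
  by rewrite FW.
- rewrite -subset0 => y [Ay [Uy Wy]]; have Ty := AT _ Ay.
  pose y' := SigSub (mem_set Ty) : space T.
  have : B y' by rewrite BC.
  have : (~` F) y' by rewrite FW.
  by rewrite BF => ? -[].
- by move: Bb; rewrite BC => -[Ab Ub]; exists (set_val b).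
Qed.

Lemma hausdorff_opn : hausdorff_space (space T) ->
  forall x y, pts T x -> pts T y -> x <> y ->
  exists U W, [/\ opn T U, opn T W, U x, W y & U `&` W = set0].
Proof.
rewrite open_hausdorff => H x y Tx Ty xy.
have xy' : (SigSub (mem_set Tx) : space T) != SigSub (mem_set Ty).
  by apply/eqP => -[].
have [[A B] /= [/set_mem Ax /set_mem By] [oA oB /eqP AB]] := H _ _ xy'.
have [U oU EA] := open_opn oA; have [W oW EB] := open_opn oB.
exists U, W; split=> //; [by move: Ax; rewrite EA|by move: By; rewrite EB|].
have [Tsub _ _ _] := top.
rewrite -subset0 => z [Uz Wz]; have Tz := Tsub _ oU _ Uz.
have : (A `&` B) (SigSub (mem_set Tz)) by rewrite EA EB.
by rewrite AB.
Qed.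

End Topology.

(** * Smooth atlases and diffeomorphisms between open sets *)

Section SmoothAtlas.
Context {R : realType}.

(** The chart axioms alone. Lemmas stated for them apply to the coproduct underlying the atlas
    groupoid as soon as its defining charts are checked. *)
Definition smooth_atlas {X : Type} (A : set X)
    (B : forall n, set (pmap X 'rV[R]_n)) : Prop :=
  [/\ forall n phi, B n phi -> chart_on A phi,
      forall m n phi psi, B m phi -> B n psi -> chart_compat phi psi &
      forall x, A x -> exists n (phi : pmap X 'rV[R]_n), B n phi /\ phi.`1 x].

(** Near each point the transition between two charts of the maximal atlas factors through a chart
    [chi] of [B], and smoothness is local. *)
Lemma smooth_atlas_max X (A : set X) (B : forall n, set (pmap X 'rV[R]_n)) :
  smooth_atlas A B -> smooth_atlas A (max_atlas A B).
Proof.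
move=> [Bc BB Bcov].
have sub n phi : B n phi -> max_atlas A B phi.
  by move=> Bphi; split; [exact: Bc|move=> m psi; exact: BB].
have half m n (phi : pmap X 'rV[R]_m) (psi : pmap X 'rV[R]_n) :
    max_atlas A B phi -> max_atlas A B psi -> eucl_smooth (pcomp psi (pinv phi)).
  move=> [[fphi fphi' _ phiA _] cphi] [[fpsi fpsi' _ _ _] cpsi].
  apply: eucl_smooth_locally => [|u [v [x /= xu xv]]].
    exact: functional_pcomp.
  have [p [chi [Bchi [w xw]]]] := Bcov _ (phiA _ (codI xu)).
  have [_ fchi' _ _ _] := Bc _ _ Bchi.
  exists (pcomp (pcomp psi (pinv chi)) (pcomp chi (pinv phi))); split.
  - by apply: eucl_smooth_pcomp; [have [] := cphi _ _ Bchi|have [] := cpsi _ _ Bchi].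
  - move=> -[a b] [c [y /= ya yc] [z /= zc zb]]; exists y => //=.
    by rewrite (fchi' _ _ _ yc zc).
  - by exists v, w => /=; exists x.
split=> [n phi []|m n phi psi hphi hpsi|x Ax] //; first by split; exact: half.
by have [n [phi [Bphi ?]]] := Bcov _ Ax; exists n, phi; split=> //; exact: sub.
Qed.

Lemma manifold_atlas X n (M : manifold R X) :
  is_manifold n M -> smooth_atlas (mset M) (@mcharts R X M).
Proof.
move=> [cov mE _ _]; split=> [p phi|p q phi psi|x Mx].
- by rewrite mE => -[].
- by rewrite {1}mE => -[_]; apply.
- by have [phi ? ?] := cov _ Mx; exists n, phi.
Qed.

Section Charts.
Context {X : Type} (M : manifold R X).
Hypothesis aM : smooth_atlas (mset M) (@mcharts R X M).

Lemma atlas_chart x : mset M x ->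
  exists n (phi : pmap X 'rV[R]_n) u, mcharts M phi /\ phi (x, u).
Proof.
have [_ _ H] := aM.
by move=> /H[n [phi [? [u ?]]]]; exists n, phi, u.
Qed.

Lemma opn_sub (U : set X) : opn (mtop M) U -> U `<=` mset M.
Proof. by case. Qed.

Lemma opn_bigcup (F : set (set X)) :
  F `<=` opn (mtop M) -> opn (mtop M) (\bigcup_(U in F) U).
Proof.
move=> FM; split=> [x [U /FM[UM _]]|n phi cphi]; first exact: UM.
rewrite (_ : pimg _ _ = \bigcup_(U in F) pimg phi U).
  by apply: bigcup_open => U /FM[_]; exact.
apply/seteqP; split=> u.
  by move=> [x [U FU Ux] xu]; exists U => //; exists x.
by move=> [U FU [x Ux xu]]; exists x => //; exists U.
Qed.

Lemma opnI (U V : set X) :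
  opn (mtop M) U -> opn (mtop M) V -> opn (mtop M) (U `&` V).
Proof.
have [Mc _ _] := aM.
move=> [UM oU] [VM oV]; split=> [x [/UM]//|n phi cphi].
have [_ fphi' _ _ _] := Mc _ _ cphi.
rewrite (_ : pimg _ _ = pimg phi U `&` pimg phi V).
  by apply: openI; [exact: oU|exact: oV].
apply/seteqP; split=> u.
  by move=> [x [Ux Vx] xu]; split; exists x.
move=> [[x Ux xu] [y Vy yu]]; exists x => //; split=> //.
by rewrite (fphi' _ _ _ xu yu).
Qed.

Lemma opn_mset : opn (mtop M) (mset M).
Proof.
have [Mc _ _] := aM.
split=> // n phi cphi; have [_ _ _ phiM ophi] := Mc _ _ cphi.
rewrite (_ : pimg _ _ = phi.`2)//.
apply/seteqP; split=> u; first by move=> [x _ xu]; exists x.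
by move=> [x xu]; exists x => //; apply: phiM; exact: domI xu.
Qed.

Lemma mtop_topology : is_topology (mtop M).
Proof.
split; [by move=> U []|exact: opn_mset|exact: opnI|exact: opn_bigcup].
Qed.

Lemma opn_chart n (phi : pmap X 'rV[R]_n) O : mcharts M phi -> open O ->
  opn (mtop M) [set x | exists2 u, phi (x, u) & O u].
Proof.
have [Mc cc _] := aM.
move=> cphi oO; have [_ _ _ phiM _] := Mc _ _ cphi.
split=> [x [u xu _]|m psi cpsi]; first by apply: phiM; exact: domI xu.
have [_ s] := cc _ _ _ _ cphi cpsi.
rewrite (_ : pimg _ _ = [set v | exists2 u, pcomp phi (pinv psi) (v, u) & O u]).
  exact: eucl_smooth_preimage.
apply/seteqP; split=> v.
  by move=> [x [u xu Ou] xv]; exists u => //; exists x.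
by move=> [u [x /= xv xu] Ou]; exists x => //; exists u.
Qed.

Lemma opn_chart_dom n (phi : pmap X 'rV[R]_n) :
  mcharts M phi -> opn (mtop M) phi.`1.
Proof.
move=> cphi; rewrite (_ : phi.`1 = [set x | exists2 u, phi (x, u) & setT u]).
  by apply: opn_chart => //; exact: openT.
by apply/seteqP; split=> x [u]; exists u.
Qed.

End Charts.

Section Diffeo.
Context {X Y : Type} (M : manifold R X) (N : manifold R Y).
Hypothesis aM : smooth_atlas (mset M) (@mcharts R X M).
Hypothesis aN : smooth_atlas (mset N) (@mcharts R Y N).

Lemma open_diffeo_pinv f : open_diffeo M N f -> open_diffeo N M (pinv f).
Proof. by move=> [[? ?] ? ? ? ?]; split; rewrite ?pinvK. Qed.

Lemma opn_preimage f W : open_diffeo M N f -> opn (mtop N) W ->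
  opn (mtop M) [set x | exists2 y, f (x, y) & W y].
Proof.
move=> [[ff _] [fM _] _ sf _] [WN oW].
split=> [x [y xy _]|m phi cphi]; first by apply: fM; exact: domI xy.
rewrite openE => u [x [y xy Wy] xu].
have [n [psi [v [cpsi yv]]]] := atlas_chart aN (WN _ Wy).
have [Nc _ _] := aN; have [_ fpsi' _ _ _] := Nc _ _ cpsi.
have o := eucl_smooth_preimage (sf _ _ _ _ cphi cpsi) (oW _ _ cpsi).
rewrite /interior; apply: filterS (open_nbhs_nbhs (conj o _)).
  move=> u' [v' [y' [x' /= xu' xy' yv'] [w Ww wv']]].
  by exists x' => //; exists y' => //; rewrite (fpsi' _ _ _ yv' wv').
by exists v; [exists y => //; exists x|exists y].
Qed.

Lemma smooth_map_prestr f U : smooth_map M N f -> opn (mtop M) U ->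
  smooth_map M N (prestr f U).
Proof.
move=> sf [_ oU] m n phi psi cphi cpsi.
have [Mc _ _] := aM; have [_ fphi' _ _ _] := Mc _ _ cphi.
rewrite (_ : pcomp _ _ = prestr (pcomp psi (pcomp f (pinv phi))) (pimg phi U)).
  by apply: eucl_smooth_prestr; [exact: oU|exact: sf].
apply/seteqP; split=> -[u v] /=.
  move=> [y [x /= xu [xy Ux]] yv]; split; last by exists x.
  by exists y => //; exists x.
move=> [[y [x /= xu xy] yv] [z Uz zu]]; exists y => //; exists x => //; split => //=.
by rewrite (fphi' _ _ _ xu zu).
Qed.

End Diffeo.

Lemma open_diffeo_prestr X Y (M : manifold R X) (N : manifold R Y) f U :
  smooth_atlas (mset M) (@mcharts R X M) -> smooth_atlas (mset N) (@mcharts R Y N) ->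
  open_diffeo M N f -> opn (mtop M) U -> open_diffeo M N (prestr f U).
Proof.
move=> aM aN df oU.
have oV := opn_preimage aM (open_diffeo_pinv df) oU.
have [[ff ff'] of1 of2 sf sf'] := df.
have E : pinv (prestr f U) = prestr (pinv f) [set x | exists2 y, pinv f (x, y) & U y].
  apply/seteqP; split=> -[y x] /=; first by move=> [xy Ux]; split=> //; exists x.
  by move=> [xy [x' x'y Ux']]; split=> //=; rewrite (ff' _ _ _ xy x'y).
split.
- by split; [|rewrite E]; exact: functional_prestr.
- rewrite (_ : _.`1 = f.`1 `&` U); first exact: opnI.
  apply/seteqP; split=> x; first by move=> [y [? ?]]; split=> //; exists y.
  by move=> [[y ?] ?]; exists y.
- rewrite (_ : _.`2 = [set x | exists2 y, pinv f (x, y) & U y]) //.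
  apply/seteqP; split=> y; first by move=> [x [? ?]]; exists x.
  by move=> [x ? ?]; exists x.
- exact: smooth_map_prestr.
- by rewrite E; exact: smooth_map_prestr.
Qed.

Lemma smooth_map_pcomp X Y Z (M : manifold R X) (N : manifold R Y) (P : manifold R Z)
    (g : pmap Y Z) (f : pmap X Y) :
  smooth_atlas (mset M) (@mcharts R X M) -> smooth_atlas (mset N) (@mcharts R Y N) ->
  smooth_atlas (mset P) (@mcharts R Z P) ->
  functional f -> functional g -> f.`2 `<=` mset N ->
  smooth_map M N f -> smooth_map N P g -> smooth_map M P (pcomp g f).
Proof.
move=> aM aN aP ff fg fN sf sg m n phi psi cphi cpsi.
have [Mc _ _] := aM; have [_ fphi' _ _ _] := Mc _ _ cphi.
have [Pc _ _] := aP; have [fpsi _ _ _ _] := Pc _ _ cpsi.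
apply: eucl_smooth_locally.
  by do 3?apply: functional_pcomp.
move=> u [v [z [x /= xu [y /= xy yz]] zv]].
have [p [chi [w [cchi yw]]]] := atlas_chart aN (fN _ (codI xy)).
have [Nc _ _] := aN; have [_ fchi' _ _ _] := Nc _ _ cchi.
exists (pcomp (pcomp psi (pcomp g (pinv chi))) (pcomp chi (pcomp f (pinv phi)))).
split.
- by apply: eucl_smooth_pcomp; [exact: sf|exact: sg].
- move=> -[a b] [c [y1 [x1 /= x1a x1y1] y1c] [z1 [y2 /= y2c y2z1] z1b]].
  exists z1 => //; exists x1 => //; exists y1 => //=.
  by rewrite (fchi' _ _ _ y1c y2c).
- by exists v, w; [exists y => //; exists x|exists z => //; exists y].
Qed.

Lemma open_diffeo_pcomp X Y Z (M : manifold R X) (N : manifold R Y) (P : manifold R Z)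
    (g : pmap Y Z) (f : pmap X Y) :
  smooth_atlas (mset M) (@mcharts R X M) -> smooth_atlas (mset N) (@mcharts R Y N) ->
  smooth_atlas (mset P) (@mcharts R Z P) ->
  open_diffeo M N f -> open_diffeo N P g -> open_diffeo M P (pcomp g f).
Proof.
move=> aM aN aP df dg.
have [[ff ff'] of1 of2 sf sf'] := df; have [[fg fg'] og1 og2 sg sg'] := dg.
split.
- by split; rewrite ?pinv_pcomp; exact: functional_pcomp.
- rewrite (_ : _.`1 = [set x | exists2 y, f (x, y) & g.`1 y]).
    exact: opn_preimage df og1.
  apply/seteqP; split=> x; first by move=> [z [y /= ? ?]]; exists y => //; exists z.
  by move=> [y ? [z ?]]; exists z, y.
- rewrite (_ : _.`2 = [set z | exists2 y, pinv g (z, y) & f.`2 y]).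
    exact: opn_preimage (open_diffeo_pinv dg) of2.
  apply/seteqP; split=> z; first by move=> [x [y /= ? ?]]; exists y => //; exists x.
  by move=> [y ? [x ?]]; exists x, y.
- by apply: smooth_map_pcomp sf sg => //; exact: opn_sub.
- rewrite pinv_pcomp; apply: smooth_map_pcomp sg' sf' => //.
  exact: opn_sub og1.
Qed.

Lemma open_diffeo_pid X (M : manifold R X) :
  smooth_atlas (mset M) (@mcharts R X M) -> open_diffeo M M (pid (mset M)).
Proof.
move=> aM.
have E : pinv (pid (mset M)) = pid (mset M).
  by apply/seteqP; split=> -[x y] [/= ? ->].
have fid : functional (pid (mset M)) by move=> x y z [_ /= ->] [_ /= ->].
have d1 : (pid (mset M)).`1 = mset M.
  by apply/seteqP; split=> [x [y []]|x Mx] //; exists x.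
have d2 : (pid (mset M)).`2 = mset M.
  by apply/seteqP; split=> [y [x [/= ? ->]]|x Mx] //; exists x.
have s : smooth_map M M (pid (mset M)).
  move=> m n phi psi cphi cpsi; have [Mc cc _] := aM.
  have [_ _ _ phiM _] := Mc _ _ cphi.
  rewrite (_ : pcomp _ _ = pcomp psi (pinv phi)); first by have [] := cc _ _ _ _ cphi cpsi.
  apply/seteqP; split=> -[u v].
    by move=> [y [x /= xu [/= _ ->]] yv]; exists x.
  move=> [x /= xu xv]; exists x => //; exists x => //; split=> //=.
  by apply: phiM; exact: codI xu.
by split; rewrite ?E ?d1 ?d2 //; exact: opn_mset.
Qed.

End SmoothAtlas.

(** * Diffeomorphisms of finite order *)

Section FiniteGroups.
Context {R : realType} {X : Type} (M : manifold R X).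
Hypothesis aM : smooth_atlas (mset M) (@mcharts R X M).

Lemma diff_total f x : diff M f -> mset M x -> exists2 y, f (x, y) & mset M y.
Proof.
move=> [_ f1 f2] Mx; have [y xy] : f.`1 x by rewrite f1.
by exists y => //; rewrite -f2; exists x.
Qed.

Lemma diff_dom f x y : diff M f -> f (x, y) -> mset M x.
Proof. by move=> [_ <- _] ?; exists y. Qed.

Lemma diff_cod f x y : diff M f -> f (x, y) -> mset M y.
Proof. by move=> [_ _ <-] ?; exists x. Qed.

Lemma diff_fun f : diff M f -> functional f.
Proof. by move=> [[[]]]. Qed.

Lemma diff_inj f : diff M f -> functional (pinv f).
Proof. by move=> [[[]]]. Qed.

Lemma diff_open f : diff M f -> open_diffeo M M f.
Proof. by case. Qed.

Lemma diff_pid : diff M (pid (mset M)).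
Proof.
split; first exact: open_diffeo_pid.
  by apply/seteqP; split=> [x [y []]|x Mx] //; exists x.
by apply/seteqP; split=> [y [x [/= ? ->]]|x Mx] //; exists x.
Qed.

Lemma diff_pinv f : diff M f -> diff M (pinv f).
Proof. by move=> [df f1 f2]; split=> //; exact: open_diffeo_pinv. Qed.

Lemma diff_pcomp g f : diff M g -> diff M f -> diff M (pcomp g f).
Proof.
move=> dg df; split.
- exact: open_diffeo_pcomp (diff_open df) (diff_open dg).
- apply/seteqP; split=> x; first by move=> [z [y /= xy _]]; exact: diff_dom xy.
  by move=> /(diff_total df)[y xy /(diff_total dg)[z yz _]]; exists z, y.
- apply/seteqP; split=> z; first by move=> [x [y /= _ yz]]; exact: diff_cod yz.
  move=> /(diff_total (diff_pinv dg))[y yz /(diff_total (diff_pinv df))[x xy _]].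
  by exists x, y.
Qed.

Lemma pcomp_pid f : diff M f -> pcomp f (pid (mset M)) = f.
Proof.
move=> df; apply/seteqP; split=> -[x y]; first by move=> [z [/= _ ->]].
by move=> xy; exists x => //; split=> //=; exact: diff_dom xy.
Qed.

Lemma pid_pcomp f : diff M f -> pcomp (pid (mset M)) f = f.
Proof.
move=> df; apply/seteqP; split=> -[x y]; first by move=> [z /= xz [/= _ ->]].
by move=> xy; exists y => //; split=> //=; exact: diff_cod xy.
Qed.

Definition ppow (k : pmap X X) (i : nat) : pmap X X :=
  iter i (pcomp k) (pid (mset M)).

Lemma diff_ppow k i : diff M k -> diff M (ppow k i).
Proof.
by move=> dk; elim: i => [|i IH] /=; [exact: diff_pid|exact: diff_pcomp].
Qed.

Lemma ppowD k i j : diff M k -> ppow k (i + j) = pcomp (ppow k i) (ppow k j).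
Proof.
move=> dk; elim: i => [|i IH]; first by rewrite pid_pcomp//; exact: diff_ppow.
by rewrite addSn /= -/(ppow k i) -pcompA -IH.
Qed.

Lemma ppowSr k i : diff M k -> ppow k i.+1 = pcomp (ppow k i) k.
Proof. by move=> dk; rewrite -addn1 ppowD// /ppow /= pcomp_pid. Qed.

(** Pigeonhole: the powers of [k] stay in the finite set [G], so two of them coincide, and the
    smaller power is cancelled pointwise by injectivity. *)
Lemma finite_order G k : finite_subgroup M G -> G k ->
  exists2 m, (0 < m)%N & ppow k m = pid (mset M).
Proof.
move=> [fG Gd G1 GM _] Gk; have dk := Gd _ Gk.
have Gp i : G (ppow k i) by elim: i => [|i IH] //=; exact: GM.
have [i [j [ij E]]] : exists i j, (i < j)%N /\ ppow k i = ppow k j.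
  apply: contrapT => H.
  have inj : {in [set: nat] &, injective (ppow k)}.
    move=> i j _ _ E; apply/eqP; rewrite eqn_leq; apply/andP; split.
      by rewrite leqNgt; apply/negP => ji; apply: H; exists j, i.
    by rewrite leqNgt; apply/negP => ij; apply: H; exists i, j.
  have fI : finite_set [set ppow k i | i in [set: nat]].
    by apply: sub_finite_set fG => _ [i _ <-].
  by move: fI; rewrite (eq_finite_set (inj_card_eq inj)); exact: infinite_nat.
exists (j - i)%N; first by rewrite subn_gt0.
have dj : diff M (ppow k (j - i)) by exact: diff_ppow.
have fixed x : mset M x -> ppow k (j - i) (x, x).
  move=> Mx; have [y xy My] := diff_total dj Mx.
  have [z yz _] := diff_total (diff_ppow i dk) My.
  have xz : ppow k i (x, z) by rewrite E -(subnKC (ltnW ij)) ppowD//; exists y.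
  by rewrite {2}(diff_inj (diff_ppow i dk) xz yz).
apply/seteqP; split=> -[x y].
  move=> xy; split; first exact: diff_dom xy.
  exact: (diff_fun dj xy (fixed _ (diff_dom dj xy))).
by move=> [/= Mx ->]; exact: fixed.
Qed.

End FiniteGroups.

(** * Maps tangent to the identity, and Bochner's argument *)

Section TangentIdentity.
Context {R : realType} {X : Type} (M : manifold R X).
Hypothesis aM : smooth_atlas (mset M) (@mcharts R X M).

(* On N the expression of a in the chart phi differs from the identity by a
   map with Lipschitz constant eps. *)
Definition close_to_id {n} (phi : pmap X 'rV[R]_n) (eps : R) (a : pmap X X)
    (N : set X) :=
  [/\ N `<=` phi.`1,
      forall y, N y -> exists2 y', a (y, y') & phi.`1 y' &
      forall y z y' z' u v u' v', N y -> N z -> a (y, y') -> a (z, z') ->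
        phi (y, u) -> phi (z, v) -> phi (y', u') -> phi (z', v') ->
        `|u' - v' - (u - v)| <= eps * `|u - v|].

(* a x = x and the differential of a at x is the identity, which is strict
   differentiability at x as the maps considered are C^1. *)
Definition tangent_id {n} (phi : pmap X 'rV[R]_n) (a : pmap X X) (x : X) :=
  a (x, x) /\ forall eps, 0 < eps -> exists N,
    [/\ opn (mtop M) N, N x & close_to_id phi eps a N].

Lemma close_to_id_sub n (phi : pmap X 'rV[R]_n) eps a (N N' : set X) :
  N' `<=` N -> close_to_id phi eps a N -> close_to_id phi eps a N'.
Proof.
move=> NN [N1 N2 N3]; split=> [y /NN/N1//|y /NN/N2//|y z y' z' u v u' v' /NN ? /NN ?].
exact: N3.
Qed.

Lemma tangent_id_pcomp n (phi : pmap X 'rV[R]_n) b a x : mcharts M phi ->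
  diff M a -> diff M b -> tangent_id phi a x -> tangent_id phi b x ->
  tangent_id phi (pcomp b a) x.
Proof.
move=> cphi da db [ax ha] [bx hb]; split=> [|eps eps0]; first by exists x.
(* If both maps are [d]-close to the identity and d <= 1, then |u' - v'| <= 2 |u - v|, and the two
   errors add up to at most (2 d + d) |u - v|; hence the 3. *)
pose d := Num.min 1 (eps / 3%:R).
have d0 : 0 < d by rewrite lt_min ltr01 divr_gt0.
have d1 : d <= 1 by rewrite ge_min lexx.
have d3 : 3%:R * d <= eps by rewrite -ler_pdivlMl// ge_min mulrC lexx orbT.
have [Na [oa Nax [a1 a2 a3]]] := ha _ d0; have [Nb [ob Nbx [b1 b2 b3]]] := hb _ d0.
exists (Na `&` [set y | exists2 y', a (y, y') & Nb y']); split.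
- apply: opnI => //; exact: (opn_preimage aM (diff_open da) ob).
- by split=> //; exists x.
split=> [y [/a1]//|y [_ [y' yy' /b2[y'' y'y'' ?]]]|].
  by exists y'' => //; exists y'.
move=> y z y'' z'' u v u'' v'' [Ny [y1 yy1 N1]] [Nz [z1 zz1 N2]].
move=> [y' /= yy' y'y''] [z' /= zz' z'z''] yu zv y''u'' z''v''.
have fa := diff_fun da.
rewrite (fa _ _ _ yy1 yy') in N1; rewrite (fa _ _ _ zz1 zz') in N2.
have [u' y'u'] := b1 _ N1; have [v' z'v'] := b1 _ N2.
have ea := a3 _ _ _ _ _ _ _ _ Ny Nz yy' zz' yu zv y'u' z'v'.
have eb := b3 _ _ _ _ _ _ _ _ N1 N2 y'y'' z'z'' y'u' z'v' y''u'' z''v''.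
have uv' : `|u' - v'| <= 2%:R * `|u - v|.
  rewrite -[u' - v'](subrK (u - v)); apply: le_trans (ler_normD _ _) _.
  rewrite mulrDl mul1r lerD2r; apply: le_trans ea _.
  by rewrite ler_piMl.
rewrite (_ : _ - _ = (u'' - v'' - (u' - v')) + (u' - v' - (u - v))); last first.
  by rewrite addrA subrK.
apply: le_trans (ler_normD _ _) _.
apply: le_trans (lerD eb ea) _.
apply: (@le_trans _ _ (3%:R * d * `|u - v|)); last by rewrite ler_wpM2r.
have : d * `|u' - v'| <= d * (2%:R * `|u - v|) by rewrite ler_wpM2l// ltW.
lra.
Qed.

Lemma tangent_id_pid n (phi : pmap X 'rV[R]_n) x : mcharts M phi -> phi.`1 x ->
  tangent_id phi (pid (mset M)) x.
Proof.
move=> cphi phix; have [Mc _ _] := aM; have [fphi _ _ phiM _] := Mc _ _ cphi.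
split=> [|eps eps0]; first by split=> //=; exact: phiM.
exists phi.`1; split=> //; first exact: opn_chart_dom.
split=> // [y phiy|]; first by exists y => //; split=> //=; exact: phiM.
move=> y z y' z' u v u' v' _ _ [/= _ ->] [/= _ ->] yu zv yu' zv'.
by rewrite (fphi _ _ _ yu' yu) (fphi _ _ _ zv' zv) subrr normr0 mulr_ge0// ltW.
Qed.

(* Bochner's linearization argument: if k^m = id, summing
   phi (k^(i+1) y) - phi (k^i y) over i < m gives 0, while each term is close
   to phi (k y) - phi y. *)
Lemma tangent_id_finite_order n (phi : pmap X 'rV[R]_n) k m x :
  mcharts M phi -> phi.`1 x -> diff M k -> (0 < m)%N ->
  ppow M k m = pid (mset M) -> tangent_id phi k x ->
  exists N, [/\ opn (mtop M) N, N x & forall y, N y -> k (y, y)].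
Proof.
move=> cphi phix dk m0 km tk.
have [Mc _ _] := aM; have [fphi fphi' _ phiM _] := Mc _ _ cphi.
have tki i : tangent_id phi (ppow M k i) x.
  elim: i => [|i IH]; first exact: tangent_id_pid.
  by apply: tangent_id_pcomp => //; exact: diff_ppow.
(* Any constant below 1 would serve: the sum will give m |u - u1| <= (m / 2) |u - u1|, which forces
   u = u1. *)
have h0 : (0 : R) < 2%:R^-1 by rewrite invr_gt0.
have [N [oN Nx cN]] : exists N, [/\ opn (mtop M) N, N x &
    forall i, (i <= m)%N -> close_to_id phi 2%:R^-1 (ppow M k i) N].
  elim: m {m0 km} => [|m [N [oN Nx cN]]].
    have [_ /(_ _ h0)[N [oN Nx cN]]] := tki 0%N.
    by exists N; split=> // i; rewrite leqn0 => /eqP ->.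
  have [_ /(_ _ h0)[N' [oN' Nx' cN']]] := tki m.+1.
  exists (N `&` N'); split=> [||i]; [exact: opnI|by []|].
  rewrite leq_eqVlt => /orP[/eqP ->|]; first by apply: close_to_id_sub cN' => y [].
  by rewrite ltnS => /cN; apply: close_to_id_sub => y [].
(* The estimates will be applied to the pair y, k y, so both points have to lie in [N]. *)
exists (N `&` [set y | exists2 y', k (y, y') & N y']); split.
- apply: opnI => //; exact: (opn_preimage aM (diff_open dk) oN).
- by split=> //; exists x => //; case: tk.
move=> y [Ny [y1 yy1 Ny1]].
have [c1 _ _] := cN 0%N isT; have [u yu] := c1 _ Ny; have [u1 yu1] := c1 _ Ny1.
(* Here [yi] is k^i y. Closeness of k^i to the identity on the pair y, k y compares u_i - u_(i+1)
   with u - u1, and these differences telescope to u - u_i. *)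
have step i : (i <= m)%N -> exists yi ui, [/\ ppow M k i (y, yi), phi (yi, ui) &
    `|u - ui - (u - u1) *+ i| <= 2%:R^-1 * `|u - u1| *+ i].
  elim: i => [_|i IH im].
    exists y, u; split=> //; first by split=> //=; exact: phiM _ (domI yu).
    by rewrite !mulr0n subr0 subrr normr0.
  have [yi [ui [yyi yui ei]]] := IH (ltnW im).
  have [_ c2 c3] := cN i (ltnW im).
  have [y' y1y' [u' yu']] := c2 _ Ny1.
  exists y', u'; split=> //; first by rewrite ppowSr//; exists y1.
  have e := c3 _ _ _ _ _ _ _ _ Ny Ny1 yyi y1y' yu yu1 yui yu'.
  rewrite !(mulrSr _ i) (_ : _ - _ = (u - ui - (u - u1) *+ i) + (ui - u' - (u - u1))).
    by apply: le_trans (ler_normD _ _) _; exact: lerD.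
  by rewrite [RHS]addrACA subrKA opprD.
have [ym [um [yym yum em]]] := step m (leqnn m).
move: yym em; rewrite km => -[/= _ ymy].
rewrite ymy in yum; rewrite (fphi _ _ _ yum yu) subrr add0r normrN normrMn.
rewrite lerMn2r gtn_eqF//= => em.
have u0 : `|u - u1| = 0 by apply/eqP; rewrite eq_le normr_ge0 andbT; lra.
move/normr0_eq0/eqP: u0; rewrite subr_eq0 => /eqP uu1.
by rewrite uu1 in yu; rewrite {2}(fphi' _ _ _ yu yu1).
Qed.

Hypothesis hM : hausdorff_space (space (mtop M)).

(** Disjoint neighborhoods of the two values pull back to a neighborhood of [x] on which the values
    stay apart. *)
Lemma opn_neq f g x y y' : diff M f -> diff M g -> f (x, y) -> g (x, y') ->
  y <> y' -> exists N, [/\ opn (mtop M) N, N x &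
    forall z w, N z -> f (z, w) -> ~ g (z, w)].
Proof.
move=> df dg xy xy' yy'.
have [U [W [oU oW Uy Wy' UW]]] :=
  hausdorff_opn (mtop_topology aM) hM (diff_cod df xy) (diff_cod dg xy') yy'.
exists ([set z | exists2 w, f (z, w) & U w] `&` [set z | exists2 w, g (z, w) & W w]).
split.
- apply: opnI => //; [exact: (opn_preimage aM (diff_open df) oU)|].
  exact: (opn_preimage aM (diff_open dg) oW).
- by split; [exists y|exists y'].
move=> z w [[w1 zw1 Uw1] [w2 zw2 Ww2]] zw zw'.
have : (U `&` W) w.
  split; first by rewrite (diff_fun df zw zw1).
  by rewrite (diff_fun dg zw' zw2).
by rewrite UW.
Qed.

Definition adherent (A : set X) (x : X) :=
  forall N, opn (mtop M) N -> N x -> A `&` N !=set0.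

(** Both value and first derivative pass to the limit: [opn_neq], against the identity, shows that
    [a] fixes [x], and [strict_identity] is applied to the expression of [a] in the chart. *)
Lemma tangent_id_adherent n (phi : pmap X 'rV[R]_n) a A x : mcharts M phi ->
  phi.`1 x -> diff M a -> opn (mtop M) A -> (forall y, A y -> a (y, y)) ->
  adherent A x -> tangent_id phi a x.
Proof.
move=> cphi [p xp] da oA aA clA.
have [Mc _ _] := aM; have [fphi fphi' _ phiM _] := Mc _ _ cphi.
have Mx : mset M x by apply: phiM; exact: domI xp.
have ax : a (x, x).
  have [x' xx' Mx'] := diff_total da Mx.
  have [E|xx] := pselect (x = x'); first by rewrite {2}E.
  have xid : pid (mset M) (x, x) by [].
  have [N [oN Nx H]] := opn_neq (diff_pid aM) da xid xx' xx.
  have [y [Ay Ny]] := clA _ oN Nx.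
  have yid : pid (mset M) (y, y) by split=> //=; exact: opn_sub oN _ Ny.
  by case: (H _ _ Ny yid); exact: aA.
split=> // eps eps0.
have [_ _ _ sa _] := diff_open da.
have [oO [f gf Cf]] := sa _ _ _ _ cphi cphi.
set g := pcomp phi _ in oO gf Cf.
have gE y y' u u' : a (y, y') -> phi (y, u) -> phi (y', u') -> g (u, u').
  by move=> yy' yu yu'; exists y' => //; exists y.
have fE u u' : g (u, u') -> u' = f u by rewrite {1}gf => -[].
have [] := @strict_identity R n f g.`1 (pimg phi A) p eps oO (Cf 1%N).
- by exists p; exact: (gE _ _ _ _ ax xp xp).
- by case: oA => _; exact.
- by move=> u [y Ay yu]; apply/esym/fE/(gE _ _ _ _ (aA _ Ay)).
- move=> N; rewrite nbhsE => -[B [oB Bp] BN].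
  have [|y [Ay [u yu Bu]]] := clA _ (opn_chart aM cphi oB); first by exists p.
  by exists u; split; [exists y|exact: BN].
- by [].
move=> r r0 Hr.
have oB : open (ball p r `&` g.`1) by apply: openI => //; exact: ball_open.
(* Intersecting the ball with the domain of the coordinate expression keeps the images under [a]
   inside the chart. *)
exists [set y | exists2 u, phi (y, u) & (ball p r `&` g.`1) u]; split.
- exact: opn_chart.
- by exists p => //; split; [exact: ballxx|exists p; exact: (gE _ _ _ _ ax xp xp)].
split=> [y [u yu _]|y [u yu [_ [u' [y' [z /= zu zy'] y'u']]]]|]; first by exists u.
  by exists y'; [rewrite (fphi' _ _ _ yu zu)|exists u'].
move=> y z y' z' u v u' v' [u1 yu1 [Bu _]] [v1 zv1 [Bv _]] yy' zz' yu zv yu' zv'.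
rewrite (fphi _ _ _ yu1 yu) in Bu; rewrite (fphi _ _ _ zv1 zv) in Bv.
by rewrite (fE _ _ (gE _ _ _ _ yy' yu yu')) (fE _ _ (gE _ _ _ _ zz' zv zv')); exact: Hr.
Qed.

Hypothesis cM : tconnected (mtop M) (mset M).

Lemma finite_order_id k m A : diff M k -> (0 < m)%N ->
  ppow M k m = pid (mset M) -> opn (mtop M) A -> A !=set0 ->
  (forall y, A y -> k (y, y)) -> k = pid (mset M).
Proof.
move=> dk m0 km oA [a Aa] kA.
pose S := \bigcup_(N in [set N | opn (mtop M) N /\ forall y, N y -> k (y, y)]) N.
have oS : opn (mtop M) S by apply: opn_bigcup => N [].
have kS y : S y -> k (y, y) by move=> [N [_ kN]]; exact: kN.
pose W := \bigcup_(N in [set N | opn (mtop M) N /\ S `&` N = set0]) N.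
have oW : opn (mtop M) W by apply: opn_bigcup => N [].
have MS : mset M `<=` S.
  apply: (tconnected_inseparable _ cM oS oW) => //.
  - move=> x Mx; have [clx|ncl] := pselect (adherent S x).
      left; have [n [phi [u [cphi xu]]]] := atlas_chart aM Mx.
      have phix := domI xu.
      have t := tangent_id_adherent cphi phix dk oS kS clx.
      have [N [oN Nx kN]] := tangent_id_finite_order cphi phix dk m0 km t.
      by exists N.
    right; apply: contrapT => nW; apply: ncl => N oN Nx.
    apply/set0P/eqP => SN; apply: nW; exists N => //; split=> //.
  - rewrite -subset0 => x [_ [Sx [N [_ SN] Nx]]].
    by rewrite -SN.
  - exists a; split; first exact: opn_sub oA _ Aa.
    by exists A.
apply/seteqP; split=> -[x y].
  move=> xy; have Mx := diff_dom dk xy; split=> //=.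
  exact: (diff_fun dk xy (kS _ (MS _ Mx))).
by move=> [/= Mx ->]; exact/kS/MS.
Qed.

Lemma opn_finite_bigcap (T : Type) (G : set T) (P : T -> set X -> Prop) x :
  finite_set G -> mset M x ->
  (forall g N N', P g N -> N' `<=` N -> P g N') ->
  (forall g, G g -> exists N, [/\ opn (mtop M) N, N x & P g N]) ->
  exists N, [/\ opn (mtop M) N, N x & forall g, G g -> P g N].
Proof.
move=> fG Mx Psub H.
have /finite_seqP[s {fG}sG] : finite_set (G : set {classic T}) by [].
rewrite {}sG in H *; elim: s H => [_|h s IH H].
  by exists (mset M); split=> //; exact: opn_mset.
have [|N [oN Nx PN]] := IH.
  by move=> g gs; apply: H; rewrite /= in_cons gs orbT.
have [|N' [oN' Nx' PN']] := H h; first by rewrite /= in_cons eqxx.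
exists (N `&` N'); split=> [||g]; [exact: opnI|by []|].
rewrite /= in_cons => /orP[/eqP ->|/PN PgN]; first by apply: Psub PN' _ => y [].
by apply: Psub PgN _ => y [].
Qed.

End TangentIdentity.

(** * Rigidity of finite groups of diffeomorphisms *)

Section GroupRigidity.
Context {R : realType} {X : Type} (M : manifold R X).
Hypothesis aM : smooth_atlas (mset M) (@mcharts R X M).
Hypothesis hM : hausdorff_space (space (mtop M)).
Hypothesis cM : tconnected (mtop M) (mset M).

Lemma diff_eq_agree f g : diff M f -> diff M g ->
  (forall x y, f (x, y) -> g (x, y)) -> f = g.
Proof.
move=> df dg fg; apply/seteqP; split=> -[x y]; first exact: fg.
move=> xy; have [y' xy' _] := diff_total df (diff_dom dg xy).
by rewrite (diff_fun dg xy (fg _ _ xy')).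
Qed.

(** For maps defined on all of [M] this is the interior of the set where they agree; the closed set
    F_g occurs only through [adherent]. *)
Definition agree_locus (f g : pmap X X) : set X :=
  \bigcup_(N in [set N | opn (mtop M) N /\
    forall x y, N x -> f (x, y) -> g (x, y)]) N.

Lemma opn_agree_locus f g : opn (mtop M) (agree_locus f g).
Proof. by apply: opn_bigcup => N []. Qed.

Lemma agree_locusP f g x y : agree_locus f g x -> f (x, y) -> g (x, y).
Proof. by move=> [N [_ H] Nx]; exact: H. Qed.

Lemma not_adherent A x : ~ adherent M A x ->
  exists N, [/\ opn (mtop M) N, N x & A `&` N = set0].
Proof.
move=> H; apply: contrapT => nH; apply: H => N oN Nx.
by apply/set0P/eqP => AN; apply: nH; exists N.
Qed.

Lemma adherent_agree f g x y : diff M f -> diff M g ->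
  adherent M (agree_locus f g) x -> f (x, y) -> g (x, y).
Proof.
move=> df dg H xy; have [y' xy' _] := diff_total dg (diff_dom df xy).
have [<- //|yy'] := pselect (y' = y).
have [N [oN Nx NH]] := opn_neq aM hM dg df xy' xy yy'.
have [z [az Nz]] := H _ oN Nx.
have [w zw _] := diff_total df (opn_sub oN Nz).
by case: (NH _ _ Nz (agree_locusP az zw)).
Qed.

Section Subgroup.
Variables (G : set (pmap X X)) (f : pmap X X).
Hypothesis sG : finite_subgroup M G.
Hypothesis df : diff M f.
Hypothesis fG : forall x y, f (x, y) -> grp_rel G x y.

Let Gd g : G g -> diff M g.
Proof. by case: sG => _ + _ _ _; apply. Qed.

(** The finite case of Baire's theorem: an open set missing the interior of {f = g} contains a point
    where [f] and [g] differ, hence an open subset on which they differ everywhere. This is repeated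
    for each member of [s]. *)
Lemma avoid_agreement (s : seq {classic (pmap X X)}) (N : set X) :
  opn (mtop M) N -> N !=set0 ->
  (forall g, g \in s -> diff M g /\ agree_locus f g `&` N = set0) ->
  exists N', [/\ opn (mtop M) N', N' !=set0, N' `<=` N &
    forall g x y, g \in s -> N' x -> f (x, y) -> ~ g (x, y)].
Proof.
move=> oN N0; elim: s => [_|g s IH H]; first by exists N; split=> // g x y; rewrite in_nil.
have [|N1 [oN1 N10 N1N H1]] := IH.
  by move=> h hs; apply: H; rewrite in_cons hs orbT.
have [dg gN] := H g (mem_head _ _).
have [x [N1x [y [xy nxy]]]] : exists x, N1 x /\ exists y, f (x, y) /\ ~ g (x, y).
  apply: contrapT => nH; have [x N1x] := N10.
  have : (agree_locus f g `&` N) x.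
    split; last exact: N1N.
    exists N1 => //; split=> // z w N1z zw; apply: contrapT => nzw.
    by apply: nH; exists z; split=> //; exists w.
  by rewrite gN.
have [y' xy' _] := diff_total dg (diff_dom df xy).
have yy' : y <> y' by move=> E; apply: nxy; rewrite E.
have [N2 [oN2 N2x H2]] := opn_neq aM hM df dg xy xy' yy'.
exists (N1 `&` N2); split=> [|||h z w].
- exact: opnI.
- by exists x.
- by move=> z [/N1N].
- rewrite in_cons => /orP[/eqP -> [_ N2z] zw|hs [N1z _] zw].
    exact: (H2 _ _ N2z zw).
  exact: (H1 _ _ _ hs N1z zw).
Qed.

(** Otherwise [x] has a neighborhood missing the interiors of all sets {f = g}, and
    [avoid_agreement] finds in it a point that [f] moves out of its [G]-orbit. *)
Lemma adherent_cover x : mset M x -> exists2 g, G g & adherent M (agree_locus f g) x.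
Proof.
move=> Mx; apply: contrapT => H.
have [fs _ _ _ _] := sG.
have [| |N [oN Nx NG]] := opn_finite_bigcap aM
    (P := fun g N => agree_locus f g `&` N = set0) fs Mx.
- move=> g N N' gN NN'; rewrite -subset0 -gN => y [? /NN' ?] //.
- by move=> g Gg; apply: not_adherent => ag; apply: H; exists g.
have /finite_seqP[s sE] : finite_set (G : set {classic (pmap X X)}) by [].
have Gs g : g \in s = G g :> Prop by rewrite sE.
have [||N' [oN' [y N'y] _ HN']] := @avoid_agreement s N oN.
- by exists x.
- by move=> g; rewrite Gs => Gg; split; [exact: Gd|exact: NG].
have [z yz _] := diff_total df (opn_sub oN' N'y).
have [g Gg gyz] := fG yz.
by apply: (HN' g y z) => //; rewrite Gs.
Qed.

(** In h^-1 g = (h^-1 f) (f^-1 g) each factor fixes the points of one agreement locus, so it is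
    tangent to the identity at [x]. Only the product is known to lie in [G] and so to have finite
    order. *)
Lemma adherent_unique g h x : G g -> G h -> adherent M (agree_locus f g) x ->
  adherent M (agree_locus f h) x -> mset M x -> g = h.
Proof.
move=> Gg Gh ag ah Mx; have [dg dh] := (Gd Gg, Gd Gh).
have [_ _ _ GM GV] := sG.
have [n [phi [u [cphi xu]]]] := atlas_chart aM Mx.
have phix := domI xu.
have oA := opn_agree_locus.
have dfV := diff_pinv df; have dhV := diff_pinv dh.
have t1 : tangent_id M phi (pcomp (pinv f) g) x.
  apply: (tangent_id_adherent aM hM cphi phix _ (oA f g) _ ag).
    exact: diff_pcomp.
  move=> y ay; have [z yz _] := diff_total df (opn_sub (oA _ _) ay).
  by exists z => //; exact: agree_locusP ay yz.
have t2 : tangent_id M phi (pcomp (pinv h) f) x.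
  apply: (tangent_id_adherent aM hM cphi phix _ (oA f h) _ ah).
    exact: diff_pcomp.
  move=> y ay; have [z yz _] := diff_total df (opn_sub (oA _ _) ay).
  by exists z => //; exact: agree_locusP ay yz.
have kE : pcomp (pcomp (pinv h) f) (pcomp (pinv f) g) = pcomp (pinv h) g.
  apply/seteqP; split=> -[y z] /=.
    move=> [w [v /= yv wv] [v' /= wv' zv']]; exists v => //=.
    by have -> : v = v' := diff_fun df wv wv'.
  move=> [v /= yv zv]; have [w wv _] := diff_total dfV (diff_cod dg yv).
  by exists w; exists v.
have Gk : G (pcomp (pinv h) g) by apply: GM => //; exact: GV.
have [m m0 km] := finite_order aM sG Gk.
have := tangent_id_pcomp aM cphi _ _ t1 t2; rewrite kE => tk.
have dk := Gd Gk.
have [N [oN Nx kN]] := tangent_id_finite_order aM cphi phix dk m0 km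
  (tk (diff_pcomp aM dfV dg) (diff_pcomp aM dhV df)).
have kid : pcomp (pinv h) g = pid (mset M).
  by apply: (finite_order_id aM hM cM dk m0 km oN) => //; exists x.
apply: diff_eq_agree => // y z yz.
have : pid (mset M) (y, y) by split=> //=; exact: diff_dom yz.
by rewrite -kid => -[w /= yw ?]; rewrite (diff_fun dg yz yw).
Qed.

(* The adherences of the agreement loci are disjoint closed sets covering M. *)
Lemma diff_in_subgroup : G f.
Proof.
have [[x0 Mx0] _] := cM; have [fs _ _ _ _] := sG.
have [g Gg ag] := adherent_cover Mx0.
(* [U] is the complement of the union of the F_h with h different from g, [W] that of F_g.
   Finiteness of [G] and [adherent_unique] give that F_g lies in [U]. *)
pose avoid N := forall h, G h -> h <> g -> agree_locus f h `&` N = set0.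
pose U := \bigcup_(N in [set N | opn (mtop M) N /\ avoid N]) N.
pose W := \bigcup_(N in [set N | opn (mtop M) N /\ agree_locus f g `&` N = set0]) N.
have oU : opn (mtop M) U by apply: opn_bigcup => N [].
have oW : opn (mtop M) W by apply: opn_bigcup => N [].
have Uadh x : mset M x -> adherent M (agree_locus f g) x -> U x.
  move=> Mx agx.
  have [| |N [oN Nx NG]] := opn_finite_bigcap aM
    (P := fun h N => h <> g -> agree_locus f h `&` N = set0) fs Mx.
  - by move=> h N N' hN NN' /hN {}hN; rewrite -subset0 -hN => y [? /NN' ?].
  - move=> h Gh; have [->|hg] := pselect (h = g).
      by exists (mset M); split=> //; exact: opn_mset.
    have [N [oN Nx NA]] : exists N,
        [/\ opn (mtop M) N, N x & agree_locus f h `&` N = set0].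
      by apply: not_adherent => ahx; apply: hg; exact: adherent_unique ahx agx Mx.
    by exists N.
  by exists N.
have nadh h x : G h -> h <> g -> U x -> ~ adherent M (agree_locus f h) x.
  move=> Gh hg [N [oN /(_ _ Gh hg) NA] Nx] /(_ _ oN Nx).
  by rewrite NA => -[].
have MU : mset M `<=` U.
  apply: (tconnected_inseparable _ cM oU oW) => //.
  - move=> x Mx; have [agx|/not_adherent[N [oN Nx NA]]] :=
      pselect (adherent M (agree_locus f g) x); first by left; exact: Uadh.
    by right; exists N.
  - rewrite -subset0 => x [Mx [Ux [N [oN NA] Nx]]].
    have [h Gh ahx] := adherent_cover Mx.
    have [hg|hg] := pselect (h = g); last exact: (nadh h x).
    by move: ahx => /(_ _ oN Nx); rewrite hg NA => -[].
  - by exists x0; split=> //; exact: Uadh.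
suff -> : f = g by [].
apply: diff_eq_agree => //; first exact: Gd.
move=> x y xy; have Mx := diff_dom df xy.
have [h Gh ahx] := adherent_cover Mx.
have [hg|hg] := pselect (h = g); last by case: (nadh h x Gh hg (MU _ Mx)).
by apply: adherent_agree xy => //; [exact: Gd|rewrite -hg].
Qed.

End Subgroup.

End GroupRigidity.

(** * Coproducts, orbifold charts and the marked atlas groupoid *)

Section Coproduct.
Context {R : realType} {X J : Type}.

Lemma manifold_eq (T : Type) (M N : manifold R T) : mset M = mset N ->
  (forall n (phi : pmap T 'rV[R]_n), mcharts M phi <-> mcharts N phi) -> M = N.
Proof.
case: M N => [A B] [A' B'] /= -> BB; congr Manifold.
by apply: functional_extensionality_dep => n; apply/seteqP; split=> phi /BB.
Qed.

Definition lift_chart {n} (i : J) (phi : pmap X 'rV[R]_n) : pmap (J * X) 'rV[R]_n :=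
  [set p | p.1.1 = i /\ phi (p.1.2, p.2)].

Section Charts.
Variables (I : set J) (M : J -> manifold R X).
Hypothesis aM : forall i, I i -> smooth_atlas (mset (M i)) (@mcharts R X (M i)).

Definition coprod_charts n : set (pmap (J * X) 'rV[R]_n) :=
  [set psi | exists i (phi : pmap X 'rV[R]_n),
     [/\ I i, mcharts (M i) phi & psi = lift_chart i phi]].

Lemma lift_chart_transition m n i j (phi : pmap X 'rV[R]_m) (psi : pmap X 'rV[R]_n) :
  pcomp (lift_chart j psi) (pinv (lift_chart i phi)) =
  [set p | i = j /\ pcomp psi (pinv phi) p].
Proof.
apply/seteqP; split=> -[u v].
  by move=> [[k x] /= [/= -> xu] [/= -> xv]]; split=> //; exists x.
by move=> [-> [x /= xu xv]]; exists (j, x).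
Qed.

Lemma lift_chart_compat m n i j (phi : pmap X 'rV[R]_m) (psi : pmap X 'rV[R]_n) :
  I i -> I j -> mcharts (M i) phi -> mcharts (M j) psi ->
  chart_compat (lift_chart i phi) (lift_chart j psi).
Proof.
move=> Ii Ij cphi cpsi; rewrite /chart_compat !lift_chart_transition.
have [ij|ij] := pselect (i = j); last first.
  rewrite [X in eucl_smooth X /\ _](_ : _ = set0); last first.
    by rewrite -subset0 => p [].
  rewrite [X in _ /\ eucl_smooth X](_ : _ = set0); last first.
    by rewrite -subset0 => p [] /esym.
  by split; exact: eucl_smooth0.
subst j; have [_ cc _] := aM Ii; have := cc _ _ _ _ cphi cpsi.
have E (T : Type) (A : set T) : [set p | i = i /\ A p] = A.
  by apply/seteqP; split=> p // [].
by rewrite !E.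
Qed.

Lemma lift_chart_on n i (phi : pmap X 'rV[R]_n) : I i ->
  chart_on (mset (coprod I M)) (lift_chart i phi) <-> chart_on (mset (M i)) phi.
Proof.
move=> Ii; have E : (lift_chart i phi).`2 = phi.`2.
  apply/seteqP; split=> u; first by move=> [[j x] [/= _ ?]]; exists x.
  by move=> [x xu]; exists (i, x).
split=> -[H1 H2 H3 H4 H5]; split; rewrite ?E//.
- by move=> x u v xu xv; apply: (H1 (i, x)).
- by move=> u x y xu yu; have := H2 u (i, x) (i, y) (conj erefl xu) (conj erefl yu) => -[].
- by move: H3 => [[j x] [u [/= _ xu]]]; exists x, u.
- by move=> x [u xu]; have [] := H4 (i, x); first by exists u.
- by rewrite -E.
- by move=> [j x] u v [/= _ xu] [/= _ xv]; exact: H1 xu xv.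
- move=> u [j x] [k y] [/= -> xu] [/= -> yu]; congr pair.
  exact: H2 xu yu.
- by move: H3 => [x [u xu]]; exists (i, x), u.
- by move=> [j x] [u [/= -> xu]]; split=> //=; apply: H4; exists u.
Qed.

Lemma coprod_charts_atlas : smooth_atlas (mset (coprod I M)) coprod_charts.
Proof.
split=> [n psi [i [phi [Ii cphi ->]]]|m n p1 p2|[i x] [/= Ii Mx]].
- by apply/(lift_chart_on _ Ii); have [+ _ _] := aM Ii; apply.
- move=> [i [phi [Ii cphi ->]]] [j [psi [Ij cpsi ->]]].
  exact: lift_chart_compat.
- have [n [phi [u [cphi xu]]]] := atlas_chart (aM Ii) Mx.
  by exists n, (lift_chart i phi); split; [exists i, phi|exists u].
Qed.

Lemma coprod_atlas : smooth_atlas (mset (coprod I M)) (@mcharts _ _ (coprod I M)).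
Proof. exact: smooth_atlas_max coprod_charts_atlas. Qed.

(** A chart of the coproduct may meet several summands, so the smooth structure of [M i] is read off
    from the charts over the single index [i]. Lifts over different indices have empty transition
    maps, and maximality of the atlas of [M i] gives the converse. *)
Lemma mcharts_coprod n i (phi : pmap X 'rV[R]_n) : I i ->
  mcharts (M i) = max_atlas (mset (M i)) (@mcharts _ _ (M i)) ->
  mcharts (coprod I M) (lift_chart i phi) <-> mcharts (M i) phi.
Proof.
move=> Ii ME; split.
  move=> [/(lift_chart_on _ Ii) on cc]; rewrite ME; split=> // m psi cpsi.
  have : coprod_charts (lift_chart i psi) by exists i, psi.
  move=> /cc; rewrite /chart_compat !lift_chart_transition.
  have E (T : Type) (A : set T) : [set p | i = i /\ A p] = A.
    by apply/seteqP; split=> p // [].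
  by rewrite !E.
move=> cphi; split; first by apply/(lift_chart_on _ Ii); have [+ _ _] := aM Ii; apply.
move=> m _ [j [psi [Ij cpsi ->]]]; exact: lift_chart_compat.
Qed.

End Charts.

Lemma coprod_inj (I I' : set J) (M M' : J -> manifold R X) :
  (forall i, I i -> mset (M i) !=set0 /\ exists n, is_manifold n (M i)) ->
  (forall i, I' i -> mset (M' i) !=set0 /\ exists n, is_manifold n (M' i)) ->
  coprod I M = coprod I' M' -> I = I' /\ forall i, I i -> M i = M' i.
Proof.
move=> HM HM' E.
have sE i x : (I i /\ mset (M i) x) = (I' i /\ mset (M' i) x).
  have := congr1 (fun N => mset N (i, x)) E; exact.
have II : I = I'.
  apply/seteqP; split=> i Ii.
    by have [[x Mx] _] := HM i Ii; have : I i /\ mset (M i) x by []; rewrite sE => -[].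
  by have [[x Mx] _] := HM' i Ii; have : I' i /\ mset (M' i) x by []; rewrite -sE => -[].
subst I'; split=> // i Ii.
have aM j : I j -> smooth_atlas (mset (M j)) (@mcharts R X (M j)).
  by move=> /HM[_ [n mM]]; exact: manifold_atlas mM.
have aM' j : I j -> smooth_atlas (mset (M' j)) (@mcharts R X (M' j)).
  by move=> /HM'[_ [n mM]]; exact: manifold_atlas mM.
have [_ [n [_ ME _ _]]] := HM i Ii; have [_ [n' [_ ME' _ _]]] := HM' i Ii.
apply: manifold_eq => [|m phi].
  apply/seteqP; split=> x Mx.
    by have : I i /\ mset (M i) x by []; rewrite sE => -[].
  by have : I i /\ mset (M' i) x by []; rewrite -sE => -[].
by rewrite -(mcharts_coprod aM phi Ii ME) -(mcharts_coprod aM' phi Ii ME') E.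
Qed.

End Coproduct.

(** * Fibres, groups and dimension of orbifold charts *)

Section Orbicharts.
Context {R : realType} {X Y : Type}.
Implicit Types (Q : tspace Y) (c d e : ochart R X Y).

Lemma ochart_atlas n Q c : is_ochart n Q c ->
  smooth_atlas (mset (cdom c)) (@mcharts _ _ (cdom c)).
Proof. by move=> [[mM _] _ _ _ _]; exact: manifold_atlas mM. Qed.

Lemma ochart_nonempty n Q c : is_ochart n Q c -> mset (cdom c) !=set0.
Proof. by move=> [[_ []]]. Qed.

Lemma ochart_total n Q c x : is_ochart n Q c -> mset (cdom c) x -> exists q, cmap c (x, q).
Proof. by move=> [_ _ [_ E] _ _]; rewrite -E. Qed.

Lemma ochart_dom n Q c x q : is_ochart n Q c -> cmap c (x, q) -> mset (cdom c) x.
Proof. by move=> [_ _ [_ E] _ _] xq; rewrite -E; exists q. Qed.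

Lemma finite_subgroup_diff (M : manifold R X) G g : finite_subgroup M G -> G g -> diff M g.
Proof. by move=> [_ + _ _ _]; apply. Qed.

Lemma grp_rel_refl (M : manifold R X) G x : finite_subgroup M G -> mset M x -> grp_rel G x x.
Proof. by move=> [_ _ ? _ _] Mx; exists (pid (mset M)). Qed.

Lemma grp_rel_class (M : manifold R X) G x y : finite_subgroup M G -> grp_rel G x y ->
  class (mtop M) (grp_rel G) x = class (mtop M) (grp_rel G) y.
Proof.
move=> [_ _ _ GM GV] [g Gg xy]; apply/seteqP; split=> z [Mz [h Gh hz]]; split=> //.
  by exists (pcomp h (pinv g)); [apply: GM => //; exact: GV|exists x].
by exists (pcomp h g); [exact: GM|exists y].
Qed.

(** Injectivity of the induced map equates the classes of [x] and [y], and [y] lies in its own class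
    as [cgrp c] contains the identity. *)
Lemma ochart_orbit n Q c x y q : is_ochart n Q c -> cmap c (x, q) -> cmap c (y, q) ->
  grp_rel (cgrp c) x y.
Proof.
move=> oc xq yq; have [_ sG _ _ [_ inj _ _ _]] := oc.
set ind := induced _ _ _ in inj.
have ix : ind (class (ctop c) (grp_rel (cgrp c)) x, q) by exists x.
have iy : ind (class (ctop c) (grp_rel (cgrp c)) y, q) by exists y.
have : class (ctop c) (grp_rel (cgrp c)) y y.
  by have My := ochart_dom oc yq; split=> //; exact: grp_rel_refl sG My.
by rewrite -(inj _ _ _ ix iy) => -[].
Qed.

Lemma ochart_invariant n Q c x y q : is_ochart n Q c -> grp_rel (cgrp c) x y ->
  cmap c (x, q) -> cmap c (y, q).
Proof.
move=> oc xy xq; have [_ sG _ _ [fn _ _ _ _]] := oc.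
set ind := induced _ _ _ in fn.
have My : mset (cdom c) y.
  by have [g Gg gxy] := xy; exact: diff_cod (finite_subgroup_diff sG Gg) gxy.
have [q' yq'] := ochart_total oc My.
have ix : ind (class (ctop c) (grp_rel (cgrp c)) x, q) by exists x.
have iy : ind (class (ctop c) (grp_rel (cgrp c)) x, q').
  by exists y => //=; exact: grp_rel_class sG xy.
by rewrite (fn _ _ _ ix iy).
Qed.

(** The fibres of the common map to [Q] are the orbits of either group, so an element of one group
    moves each point within its orbit under the other and [diff_in_subgroup] applies. *)
Lemma cgrp_sub n n' Q c d : is_ochart n Q c -> is_ochart n' Q d ->
  cdom c = cdom d -> cmap c = cmap d -> cgrp d `<=` cgrp c.
Proof.
move=> oc od Edom Emap g Gg.
have [[[_ _ hM _] cM] sG _ _ _] := oc; have [_ sG' _ _ _] := od.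
apply: (diff_in_subgroup (ochart_atlas oc) hM cM sG).
  by rewrite Edom; exact: finite_subgroup_diff sG' Gg.
move=> x y xy.
have Mx := diff_dom (finite_subgroup_diff sG' Gg) xy.
have [q xq] := ochart_total od Mx.
apply: (@ochart_orbit _ _ _ _ _ q oc); rewrite Emap//.
by apply: ochart_invariant od _ xq; exists g.
Qed.

Lemma ochart_eq n n' Q c d : is_ochart n Q c -> is_ochart n' Q d ->
  cdom c = cdom d -> cmap c = cmap d -> c = d.
Proof.
move=> oc od Edom Emap.
have : cgrp c = cgrp d.
  by apply/seteqP; split; [exact: cgrp_sub od oc _ _|exact: cgrp_sub oc od _ _].
by case: c d Edom Emap {oc od} => [? ? ?] [? ? ?] /= -> -> ->.
Qed.

(** Each atlas comes with an existentially quantified dimension; this identifies two such dimensions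
    on a common chart domain. *)
Lemma manifold_dim m n (M : manifold R X) : is_manifold m M -> is_manifold n M ->
  mset M !=set0 -> m = n.
Proof.
move=> mM nM [x Mx].
have [_ cc _] := manifold_atlas mM.
have [covm _ _ _] := mM; have [covn _ _ _] := nM.
have [phi cphi [u xu]] := covm _ Mx; have [psi cpsi [v xv]] := covn _ Mx.
have [s1 s2] := cc _ _ _ _ cphi cpsi.
have uv : pcomp psi (pinv phi) (u, v) by exists x.
have vu : pcomp phi (pinv psi) (v, u) by exists x.
apply/eqP; rewrite eqn_leq; apply/andP; split.
  by apply: (eucl_smooth_dim s2 _ vu); rewrite pinv_pcomp pinvK.
by apply: (eucl_smooth_dim s1 _ uv); rewrite pinv_pcomp pinvK.
Qed.

End Orbicharts.

(** * Orbits and marking of the atlas groupoid *)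

Section MarkedGroupoid.
Context {R : realType} {X Y J : Type}.
Variables (I : set J) (c : J -> ochart R X Y) (n : nat) (Q : tspace Y).
Hypothesis oc : forall i, I i -> is_ochart n Q (c i).

Let aP : smooth_atlas (mset (ag_obj I c)) (@mcharts _ _ (ag_obj I c)).
Proof. by apply: coprod_atlas => i Ii; exact: ochart_atlas (oc Ii). Qed.

Lemma ag_projE i x q : I i -> ag_proj I c ((i, x), q) <-> cmap (c i) (x, q).
Proof. by move=> Ii; split=> [[]|]. Qed.

Lemma ag_proj_dom p q : ag_proj I c (p, q) -> mset (ag_obj I c) p.
Proof. by move=> [Ii xq]; split=> //; exact: ochart_dom (oc Ii) xq. Qed.

(** Source and target may present the same arrow by different transitions; as a germ records its
    base point, the transition used for the target already starts at [p]. *)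
Lemma ag_orbitP p p' :
  orbit_rel (atlas_groupoid I c) p p' <-> exists2 f, Psi I c f & f (p, p').
Proof.
split.
  move=> [a [[x [f [Pf fx [-> ->]]]] [x1 [y [g [Pg gxy [Exf _ ->]]]]]]].
  by exists g => //; rewrite Exf.
move=> [f Pf fpp']; exists (germ I c p f); split.
  by exists p, f; split=> //; exists p'.
by exists p, p', f.
Qed.

Lemma ag_orbit_refl p : mset (ag_obj I c) p -> orbit_rel (atlas_groupoid I c) p p.
Proof.
move=> Mp; apply/ag_orbitP; exists (pid (mset (ag_obj I c))); last by [].
split; first exact: open_diffeo_pid.
apply/seteqP; split=> -[x q].
  by move=> [y [/= Mx ->] yq]; split=> //; exists x.
by move=> [xq [y xy]]; exists x => //; case: xy.
Qed.

(** A representative [p'] of the class of [p] is reached from [p] by a transition in [Psi], which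
    preserves the projection; so the value on a class does not depend on the representative. *)
Lemma ag_markingP p q : mset (ag_obj I c) p ->
  ag_marking I c
    (class (mtop (ag_obj I c)) (orbit_rel (atlas_groupoid I c)) p, q) <->
  ag_proj I c (p, q).
Proof.
move=> Mp; split=> [|pq]; last by exists p.
move=> [p' /= E p'q].
have : class (mtop (ag_obj I c)) (orbit_rel (atlas_groupoid I c)) p' p'.
  have Mp' := ag_proj_dom p'q.
  by split=> //; exact: ag_orbit_refl.
rewrite -E => -[_ /ag_orbitP[f [_ Ef] fpp']].
have : pcomp (ag_proj I c) f (p, q) by exists p'.
by rewrite Ef => -[].
Qed.

End MarkedGroupoid.

(** * Transitivity of the equivalence of atlases *)

Section ConnectedNeighborhoods.
Context {R : realType}.

Lemma ball_connected n (p : 'rV[R]_n) (r : R) : 0 < r -> connected (ball p r).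
Proof.
move=> r0.
pose seg y := (fun t : R => p + t *: (y - p)) @` `[0, 1]%classic.
rewrite (_ : ball p r = \bigcup_(y in ball p r) seg y).
  apply: bigcup_connected => [|y By].
    exists p => y By; exists 0; first by rewrite /= in_itv/= lexx ler01.
    by rewrite scale0r addr0.
  apply: connected_continuous_connected; first exact: segment_connected.
  apply: continuous_subspaceT => t; apply: cvgD; first exact: cvg_cst.
  exact: scalel_continuous.
apply/seteqP; split=> y.
  move=> By; exists y => //; exists 1; first by rewrite /= in_itv/= lexx ler01.
  by rewrite scale1r addrC subrK.
move=> [z Bz [t]]; rewrite /= in_itv/= => /andP[t0 t1] <-.
move: Bz; rewrite -ball_normE /ball_/= opprD addNKr normrN normrZ distrC => Bz.
rewrite ger0_norm//; apply: le_lt_trans Bz.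
by rewrite ler_piMl.
Qed.

Section Manifold.
Context {X : Type} (M : manifold R X).
Hypothesis aM : smooth_atlas (mset M) (@mcharts R X M).

(** The neighborhood is the preimage of a coordinate ball; a separation of it is carried by the
    chart to one of the ball. *)
Lemma connected_nbhd U x : opn (mtop M) U -> U x ->
  exists N, [/\ opn (mtop M) N, N x, N `<=` U & tconnected (mtop M) N].
Proof.
move=> oU Ux; have Mx := opn_sub oU Ux.
have [n [phi [p [cphi xp]]]] := atlas_chart aM Mx.
have [Mc _ _] := aM; have [fphi fphi' _ phiM ophi] := Mc _ _ cphi.
have oimg V : opn (mtop M) V -> open (pimg phi V) by case=> _; exact.
have pU : pimg phi U p by exists x.
have [r /= r0 rU] := (nbhs_ballP _ _).1 (open_nbhs_nbhs (conj (oimg _ oU) pU)).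
have oB : open (ball p r) by exact: ball_open.
pose N := [set y | exists2 u, phi (y, u) & ball p r u].
have oN : opn (mtop M) N by exact: opn_chart.
have NU : N `<=` U.
  by move=> y [u yu /rU[z Uz zu]]; rewrite (fphi' _ _ _ yu zu).
have Nx : N x by exists p => //; exact: ballxx.
exists N; split=> //; apply: inseparable_tconnected.
- exact: mtop_topology.
- exact: opn_sub oN.
- by exists x.
move=> V W oV oW NVW NVW0 [y [[u yu Bu] Vy]] z [v zv Bv].
have E : ball p r `&` pimg phi V = ball p r.
  apply: (ball_connected r0).
  - by exists u; split=> //; exists y.
  - by exists (pimg phi V) => //; exact: oimg.
  - exists (~` pimg phi W); first exact/open_closedC/oimg.
    apply/seteqP; split=> w [Bw].
      move=> [a Va aw]; split=> // -[b Wb bw].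
      have : (N `&` (V `&` W)) a.
        by split; [exists w|split=> //; rewrite (fphi' _ _ _ aw bw)].
      by rewrite NVW0.
    move=> nWw; split=> //; have [a _ aw] := rU _ Bw.
    have [Va|Wa] := NVW a (ex_intro2 _ _ w aw Bw); first by exists a.
    by case: nWw; exists a.
have : ball p r v by [].
by rewrite -E => -[_ [a Va av]]; rewrite (fphi' _ _ _ zv av).
Qed.

End Manifold.

Lemma open_diffeo_tconnected X Y (M : manifold R X) (N : manifold R Y) f :
  smooth_atlas (mset M) (@mcharts R X M) -> smooth_atlas (mset N) (@mcharts R Y N) ->
  open_diffeo M N f -> tconnected (mtop M) f.`1 -> tconnected (mtop N) f.`2.
Proof.
move=> aM aN df cf; have [[ff ff'] of1 of2 _ _] := df.
apply: inseparable_tconnected.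
- exact: mtop_topology.
- exact: opn_sub of2.
- by have [[x [y xy]] _] := cf; exists y, x.
move=> V W oV oW fVW fVW0 [b [[a ab] Vb]] y [x xy].
have pre U : opn (mtop N) U -> opn (mtop M) [set x | exists2 y, f (x, y) & U y].
  exact: (opn_preimage aN df).
have := tconnected_inseparable (opn_sub of1 : _ `<=` pts (mtop M)) cf
  (pre _ oV) (pre _ oW).
move=> /(_ _ _ _ x (domI xy))[|||y' xy' Vy'].
- move=> z [w zw]; have [|Vw|Ww] := fVW w; first by exists z.
    by left; exists w.
  by right; exists w.
- rewrite -subset0 => z [_ [[w zw Vw] [w' zw' Ww']]].
  have : (f.`2 `&` (V `&` W)) w.
    by split; [exists z|split=> //; rewrite (ff _ _ _ zw zw')].
  by rewrite fVW0.
- by exists a; split; [exists b|exists b].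
by rewrite (ff _ _ _ xy xy').
Qed.

End ConnectedNeighborhoods.

Section AtlasEquivalence.
Context {R : realType} {X Y : Type} (Q : tspace Y).
Implicit Types c d e : ochart R X Y.

(* The diffeomorphisms witnessing compatibility of charts preserve the maps to
   Q, hence send a point to the required one only up to the group of the target
   chart. *)
Lemma ochart_compat_trans n c d :
  is_ochart n Q c -> is_ochart n Q d ->
  (forall q, (cmap c).`2 q -> exists e, [/\ is_ochart n Q e, (cmap e).`2 q,
     ochart_compat c e & ochart_compat e d]) ->
  ochart_compat c d.
Proof.
move=> oc od H x y q xq yq.
have [e [oe [z zq] ce ed]] := H q (codI xq).
have [[ac ad] ae] := (ochart_atlas oc, ochart_atlas od, ochart_atlas oe).
have [h1 [dh1 [[z1 xz1] _] _ E1]] := ce _ _ _ xq zq.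
have z1q : cmap e (z1, q).
  have : prestr (cmap c) h1.`1 (x, q) by split=> //; exists z1.
  rewrite -E1 => -[w /= xw wq].
  by have [[fh1 _] _ _ _ _] := dh1; rewrite (fh1 _ _ _ xz1 xw).
have [h2 [dh2 [[y1 zy1] _] _ E2]] := ed _ _ _ z1q yq.
have y1q : cmap d (y1, q).
  have : prestr (cmap e) h2.`1 (z1, q) by split=> //; exists y1.
  rewrite -E2 => -[w /= xw wq].
  by have [[fh2 _] _ _ _ _] := dh2; rewrite (fh2 _ _ _ zy1 xw).
(* The composite of [h1] and [h2] ends at some [y1] in the fibre of [y]; an element [g] of the group
   of [d] moves it to [y] without changing the projection. *)
have [g Gg y1y] := ochart_orbit od y1q yq.
have [_ sG _ _ _] := od.
have dg := finite_subgroup_diff sG Gg.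
have Eg : pcomp (cmap d) g = cmap d.
  apply/seteqP; split=> -[a p] /=.
    move=> [b ab bp]; have [_ _ _ _ GV] := sG.
    by apply: (ochart_invariant od _ bp); exists (pinv g); first exact: GV.
  move=> ap; have [b ab _] := diff_total dg (ochart_dom od ap).
  by exists b => //=; apply: (ochart_invariant od _ ap); exists g.
pose k := pcomp g (pcomp h2 h1).
have dk : open_diffeo (cdom c) (cdom d) k.
  apply: (open_diffeo_pcomp ac ad ad _ (diff_open dg)).
  exact: (open_diffeo_pcomp ac ae ad dh1 dh2).
have kxy : k (x, y) by exists y1 => //; exists z1.
have Ek : pcomp (cmap d) k = prestr (cmap c) k.`1.
  rewrite /k pcompA Eg pcompA E2.
  apply/seteqP; split=> -[a p] /=.
    move=> [b /= ab [/= bp [w bw]]]; split.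
      have : pcomp (cmap e) h1 (a, p) by exists b.
      by rewrite E1 => -[].
    have [_ _ oh2 _ _] := dh2.
    have [w' ww' _] := diff_total dg (opn_sub oh2 (codI bw)).
    by exists w', w => //; exists b.
  move=> [ap [w [v /= [b ab bv] vw]]].
  have : prestr (cmap c) h1.`1 (a, p) by split=> //; exists b.
  rewrite -E1 => -[b' /= ab' b'p].
  by exists b' => //; split=> //=; have [[fh1 _] _ _ _ _] := dh1;
    rewrite -(fh1 _ _ _ ab ab'); exists v.
(* The domain of the composite need not be connected, so [k] is cut down to a connected neighborhood
   of [x]. *)
have [_ ok _ _ _] := dk.
have [N [oN Nx Nk cN]] := connected_nbhd ac ok (domI kxy).
have dkN := open_diffeo_prestr ac ad dk oN.
have EN : (prestr k N).`1 = N.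
  apply/seteqP; split=> a; first by move=> [b []].
  by move=> Na; have [b ab] := Nk _ Na; exists b.
exists (prestr k N); split=> //.
- by rewrite EN.
- split; first by exists x; split.
  by apply: open_diffeo_tconnected dkN _ => //; rewrite EN.
- rewrite EN; apply/seteqP; split=> -[a p].
    move=> [b /= [ab Na] bp]; split=> //.
    have : pcomp (cmap d) k (a, p) by exists b.
    by rewrite Ek => -[].
  move=> [ap /= Na]; have : prestr (cmap c) k.`1 (a, p) by split=> //; exact: Nk.
  by rewrite -Ek => -[b /= ab bp]; exists b.
Qed.

Lemma oatlas_equiv_sym (V W : set (ochart R X Y)) :
  oatlas_equiv Q V W -> oatlas_equiv Q W V.
Proof. by move=> [? ? ?]; split=> //; rewrite setUC. Qed.

Lemma oatlas_equiv_trans (V1 V2 V3 : set (ochart R X Y)) :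
  oatlas_equiv Q V1 V2 -> oatlas_equiv Q V2 V3 -> oatlas_equiv Q V1 V3.
Proof.
move=> [a1 a2 [[n dim12] c12 _]] [_ a3 [[m dim23] c23 _]].
have [_ cc1 cov1] := a1; have [_ _ cov2] := a2; have [_ cc3 cov3] := a3.
split=> //.
(* The dimensions of the two unions are compared on a chart of [V2]. If there is none, then [Q] is
   empty, and so is [V1] because charts are non-empty. *)
have [[c0 V20]|V2n] := pselect (exists c, V2 c); last first.
  have Q0 : pts Q = set0.
    by rewrite -subset0 -cov2 => q [c V2c]; case: V2n; exists c.
  have V1n c : ~ V1 c.
    move=> V1c; have oc := dim12 _ (or_introl V1c).
    have [x Mx] := ochart_nonempty oc; have [q xq] := ochart_total oc Mx.
    have : pts Q q by rewrite -cov1; exists c => //; exists x.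
    by rewrite Q0.
  rewrite (_ : V1 `|` V3 = V3)//.
  by apply/seteqP; split=> c; [case=> // /V1n|right].
have nm : n = m.
  have o1 := dim12 _ (or_intror V20); have o2 := dim23 _ (or_introl V20).
  apply: (manifold_dim _ _ (ochart_nonempty o1)); first by have [[]] := o1.
  by have [[]] := o2.
subst m.
have mid q : pts Q q -> exists2 e, V2 e & (cmap e).`2 q.
  by rewrite -cov2 => -[e V2e eq]; exists e.
split.
- by exists n => c [V1c|V3c]; [apply: dim12; left|apply: dim23; right].
- move=> c d [cV1|cV3] [dV1|dV3]; [exact: cc1| | |exact: cc3].
  + apply: (@ochart_compat_trans n).
    * by apply: dim12; left.
    * by apply: dim23; right.
    move=> q cq; have [|e V2e eq] := mid q; first by rewrite -cov1; exists c.
    exists e; split=> //; first by apply: dim12; right.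
      by apply: c12; [left|right].
    by apply: c23; [left|right].
  + apply: (@ochart_compat_trans n).
    * by apply: dim23; right.
    * by apply: dim12; left.
    move=> q cq; have [|e V2e eq] := mid q; first by rewrite -cov3; exists c.
    exists e; split=> //; first by apply: dim12; right.
      by apply: c23; [right|left].
    by apply: c12; [right|left].
- by rewrite bigcup_setU cov1 cov3 setUid.
Qed.

(** The two classes may be formed from different atlases [V0] and [V0'], but both of these are
    equivalent to [V]. *)
Lemma orbifold_structure_eq (U U' : set (set (ochart R X Y))) V :
  orbifold_structure Q U -> orbifold_structure Q U' -> U V -> U' V -> U = U'.
Proof.
move=> [V0 _ ->] [V0' _ ->] V0V V0'V; apply/seteqP; split=> W V0W.
  exact: oatlas_equiv_trans V0'V (oatlas_equiv_trans (oatlas_equiv_sym V0V) V0W).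
exact: oatlas_equiv_trans V0V (oatlas_equiv_trans (oatlas_equiv_sym V0'V) V0W).
Qed.

End AtlasEquivalence.

(** * Recovery of the atlas and of the orbifold *)

Lemma ag_marked_groupoid_inj (R : realType) (X Y J : Type) (n n' : nat)
    (Q Q' : tspace Y) (I I' : set J) (c c' : J -> ochart R X Y) :
  (forall i, I i -> is_ochart n Q (c i)) ->
  (forall i, I' i -> is_ochart n' Q' (c' i)) ->
  marked_atlas_groupoid I c Q = marked_atlas_groupoid I' c' Q' ->
  [/\ Q = Q', I = I' & forall i, I i -> c i = c' i].
Proof.
move=> oc oc' E.
have EQ : Q = Q' by have := congr1 (@mspace _ _ _ _) E.
have EG : atlas_groupoid I c = atlas_groupoid I' c' by have := congr1 (@mgroupoid _ _ _ _) E.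
have EM : ag_marking I c = ag_marking I' c' by have := congr1 (@mhomeo _ _ _ _) E.
have EO : ag_obj I c = ag_obj I' c' by have := congr1 (@gobj _ _ _) EG.
subst Q'.
have [EI Edom] : I = I' /\ forall i, I i -> cdom (c i) = cdom (c' i).
  apply: coprod_inj EO => i Ii.
    have o := oc i Ii; split; [exact: ochart_nonempty o|exists n].
    by have [[]] := o.
  have o := oc' i Ii; split; [exact: ochart_nonempty o|exists n'].
  by have [[]] := o.
subst I'; split=> // i Ii.
(* Equal groupoids have the same orbit classes, so equal markings are evaluated at the same class of
   [p], and [ag_markingP] turns both values into projections. *)
have Eproj p q : mset (ag_obj I c) p -> ag_proj I c (p, q) <-> ag_proj I c' (p, q).
  move=> Mp; have Mp' : mset (ag_obj I c') p by rewrite -EO.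
  by rewrite -(ag_markingP oc q Mp) -(ag_markingP oc' q Mp') EM EG EO.
apply: (ochart_eq (oc i Ii) (oc' i Ii) (Edom i Ii)).
apply/seteqP; split=> -[x q] xq; apply/(ag_projE _ x q Ii).
  by apply/Eproj; [split=> //=; exact: ochart_dom (oc i Ii) xq|apply/ag_projE].
apply/Eproj; last exact/ag_projE.
by rewrite EO; split=> //=; exact: ochart_dom (oc' i Ii) xq.
Qed.

Theorem proposition3p3 (R : realType) (X Y J : Type) (cnt : countability)
    (Q Q' : tspace Y) (U U' : set (set (ochart R X Y)))
    (hQ : is_orbifold cnt Q U) (hQ' : is_orbifold cnt Q' U')
    (V V' : set (ochart R X Y))
    (hV : representative cnt U V) (hV' : representative cnt U' V')
    (I I' : set J) (c c' : J -> ochart R X Y)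
    (hc : set_bij I V c) (hc' : set_bij I' V' c') :
  marked_atlas_groupoid I c Q = marked_atlas_groupoid I' c' Q' ->
  (Q, U) = (Q', U') /\ V = V'.
Proof.
move=> E.
have [_ _ _ sU] := hQ; have [_ _ _ sU'] := hQ'.
have [UV _] := hV; have [UV' _] := hV'.
have atl W (P : tspace Y) (S : set (set (ochart R X Y))) :
    orbifold_structure P S -> S W -> is_oatlas P W by move=> [W0 _ ->] [].
have [[n dV] _ _] := atl _ _ _ sU UV; have [[n' dV'] _ _] := atl _ _ _ sU' UV'.
have [cV _ Vc] := hc; have [cV' _ Vc'] := hc'.
have [EQ EI Ec] : [/\ Q = Q', I = I' & forall i, I i -> c i = c' i].
  apply: ag_marked_groupoid_inj E => i Ii; first exact/dV/cV.
  exact/dV'/cV'.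
subst Q' I'.
have EV : V = V'.
  apply/seteqP; split=> d.
    by move=> /Vc[i Ii <-]; rewrite (Ec i Ii); exact: cV'.
  by move=> /Vc'[i Ii <-]; rewrite -(Ec i Ii); exact: cV.
subst V'; split=> //; congr pair.
exact: orbifold_structure_eq sU sU' UV UV'.
Qed.
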